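(* Under the Strong Exponential Time Hypothesis (SETH), Eccentricities does not have a sub-$mn$ time algorithm, in unweighted or weighted graphs, directed or undirected.
   Context: SETH: for every $\delta<1$ there is a $k$ such that $k$-SAT on $n$ variables cannot be solved in $O(2^{\delta n})$ time. Eccentricities: given a graph $G=(V,E)$, compute $\max_{y\in V} d_G(x,y)$ for every $x\in V$. A function $g(m,n)$ ($n$ vertices, $m$ edges) is sub-$mn$ if $g(m,n)=O(m^{\alpha}n^{\beta})$ for constants $\alpha,\beta$ with $\alpha+\beta<2$. *)

(* Defs.v *)
From Stdlib Require Import Reals Arith List Bool.
Import ListNotations.

(* Word RAM with w-bit words and unit-cost instructions. Registers and arrays
   are named by nat; a program mentions only finitely many of them, so the
   arrays amount to one interleaved memory. Control flow is structured, which
   agrees with jumps up to a constant factor in time. *)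

Inductive binop : Set :=
  | Add | Sub | Mul | Div | Mod | And | Or | Xor | Shl | Shr | Ltb | Eqb.

Inductive cmd : Set :=
  | Skip
  | Const (x c : nat)                 (* x := c *)
  | Op (o : binop) (x y z : nat)      (* x := y o z *)
  | Read (x a y : nat)                (* x := a[y] *)
  | Write (a x y : nat)               (* a[x] := y *)
  | Seq (p q : cmd)
  | If (x : nat) (p q : cmd)          (* test x <> 0 *)
  | While (x : nat) (p : cmd).

Record state : Type := State { reg : nat -> nat; mem : nat -> nat -> nat }.

Definition trunc (w v : nat) : nat := v mod 2 ^ w.

(* Sub wraps around; division by 0 follows Nat.div and Nat.modulo. *)
Definition eval_op (w : nat) (o : binop) (x y : nat) : nat :=
  trunc w
    match o with
    | Add => x + y
    | Sub => x + 2 ^ w - y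
    | Mul => x * y
    | Div => x / y
    | Mod => x mod y
    | And => Nat.land x y
    | Or => Nat.lor x y
    | Xor => Nat.lxor x y
    | Shl => Nat.shiftl x y
    | Shr => Nat.shiftr x y
    | Ltb => Nat.b2n (x <? y)
    | Eqb => Nat.b2n (x =? y)
    end.

Definition upd {A : Type} (f : nat -> A) (i : nat) (v : A) : nat -> A :=
  fun j => if j =? i then v else f j.

Definition set_reg (s : state) (x v : nat) : state :=
  State (upd (reg s) x v) (mem s).

Definition set_mem (s : state) (a i v : nat) : state :=
  State (reg s) (upd (mem s) a (upd (mem s a) i v)).

(* exec w p s t s' : from s, p halts in state s' after t steps. *)
Inductive exec (w : nat) : cmd -> state -> nat -> state -> Prop :=
  | ESkip s : exec w Skip s 1 s
  | EConst s x c : exec w (Const x c) s 1 (set_reg s x (trunc w c))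
  | EOp s o x y z :
      exec w (Op o x y z) s 1 (set_reg s x (eval_op w o (reg s y) (reg s z)))
  | ERead s x a y :
      exec w (Read x a y) s 1 (set_reg s x (mem s a (reg s y)))
  | EWrite s a x y :
      exec w (Write a x y) s 1 (set_mem s a (reg s x) (reg s y))
  | ESeq s1 s2 s3 p q t1 t2 :
      exec w p s1 t1 s2 -> exec w q s2 t2 s3 ->
      exec w (Seq p q) s1 (t1 + t2) s3
  | EIfTrue s s' x p q t :
      reg s x <> 0 -> exec w p s t s' -> exec w (If x p q) s (S t) s'
  | EIfFalse s s' x p q t :
      reg s x = 0 -> exec w q s t s' -> exec w (If x p q) s (S t) s'
  | EWhileTrue s1 s2 s3 x p t1 t2 :
      reg s1 x <> 0 -> exec w p s1 t1 s2 -> exec w (While x p) s2 t2 s3 ->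
      exec w (While x p) s1 (S (t1 + t2)) s3
  | EWhileFalse s x p : reg s x = 0 -> exec w (While x p) s 1 s.

Definition input_array : nat := 0.
Definition output_array : nat := 1.

Definition init (w : nat) (input : list nat) : state :=
  State (fun _ => 0)
        (fun a i => if a =? input_array then trunc w (nth i input 0) else 0).

(* On the given input, p halts within time T leaving an output array that
   satisfies post. *)
Definition runs (w : nat) (p : cmd) (input : list nat) (T : R)
    (post : (nat -> nat) -> Prop) : Prop :=
  exists (t : nat) (s : state),
    exec w p (init w input) t s /\ (INR t <= T)%R /\ post (mem s output_array).

(* The literal (v, true) is the variable v and (v, false) its negation. *)
Definition literal : Set := nat * bool.
Definition clause : Set := list literal.

Record cnf : Set := Cnf { nvars : nat; clauses : list clause }.

(* Clauses form a set: a formula on n variables then has size polynomial in n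
   for fixed k, so that a time bound in n alone makes sense. *)
Definition is_kcnf (k : nat) (F : cnf) : Prop :=
  NoDup (clauses F) /\
  forall C, In C (clauses F) ->
    length C <= k /\ forall l, In l C -> fst l < nvars F.

Definition satisfiable (F : cnf) : Prop :=
  exists a : nat -> bool,
    forall C, In C (clauses F) -> exists l, In l C /\ a (fst l) = snd l.

Definition encode_literal (l : literal) : nat := 2 * fst l + Nat.b2n (snd l).

Definition encode_cnf (F : cnf) : list nat :=
  nvars F :: length (clauses F) ::
  flat_map (fun C => length C :: map encode_literal C) (clauses F).

(* Words have at least c * (n + 1) bits, the constant c being chosen with the
   program: O(n) bits are what addressing 2 ^ O(n) cells takes. *)
Definition kSAT_in_time (k : nat) (T : nat -> R) : Prop :=
  exists (p : cmd) (c : nat),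
  forall F : cnf, is_kcnf k F ->
  forall w : nat, c * (nvars F + 1) <= w ->
    runs w p (encode_cnf F) (T (nvars F))
      (fun out => (satisfiable F /\ out 0 = 1) \/ (~ satisfiable F /\ out 0 = 0)).

Definition big_O (f g : nat -> R) : Prop :=
  exists (C : R) (n0 : nat), forall n, n0 <= n -> (f n <= C * g n)%R.

Definition SETH : Prop :=
  forall delta : R, (delta < 1)%R ->
  exists k : nat,
    ~ exists T : nat -> R,
        big_O T (fun n => Rpower 2 (delta * INR n)) /\ kSAT_in_time k T.

(* Vertices are 0, ..., nverts - 1; an edge is ((u, v), weight). In the
   undirected case each edge is listed once, in either orientation. *)
Record graph : Set := Graph { nverts : nat; edges : list (nat * nat * nat) }.

Definition nedges (G : graph) : nat := length (edges G).

Definition is_graph (directed weighted : bool) (G : graph) : Prop :=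
  NoDup (map fst (edges G)) /\
  (forall u v c, In (u, v, c) (edges G) ->
     u < nverts G /\ v < nverts G /\ u <> v /\ (weighted = false -> c = 1)) /\
  (directed = false ->
     forall u v, In (u, v) (map fst (edges G)) -> ~ In (v, u) (map fst (edges G))).

Definition arc (directed : bool) (G : graph) (u v c : nat) : Prop :=
  In (u, v, c) (edges G) \/ (directed = false /\ In (v, u, c) (edges G)).

Inductive walk (directed : bool) (G : graph) : nat -> nat -> nat -> Prop :=
  | WalkNil u : walk directed G u u 0
  | WalkCons u v z c l :
      arc directed G u v c -> walk directed G v z l ->
      walk directed G u z (c + l).

(* Distances and eccentricities live in option nat, with None for infinity. *)
Definition ext_le (d e : option nat) : Prop :=
  match d, e with
  | _, None => True
  | None, Some _ => False
  | Some d, Some e => d <= e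
  end.

Definition is_dist (directed : bool) (G : graph) (x y : nat) (d : option nat) : Prop :=
  match d with
  | Some d => walk directed G x y d /\ forall l, walk directed G x y l -> d <= l
  | None => forall l, ~ walk directed G x y l
  end.

Definition is_ecc (directed : bool) (G : graph) (x : nat) (e : option nat) : Prop :=
  (exists y, y < nverts G /\ is_dist directed G x y e) /\
  forall y d, y < nverts G -> is_dist directed G x y d -> ext_le d e.

Definition encode_ext (d : option nat) : nat :=
  match d with None => 0 | Some d => S d end.

Definition encode_graph (weighted : bool) (G : graph) : list nat :=
  nverts G :: nedges G ::
  flat_map (fun '(u, v, c) => if weighted then [u; v; c] else [u; v]) (edges G).

Definition max_weight (G : graph) : nat := list_max (map snd (edges G)).

(* Words have at least c * log2 (n + W + 2) bits for the maximum weight W, the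
   constant c being chosen with the program. *)
Definition Eccentricities_in_time (directed weighted : bool)
    (g : nat -> nat -> R) : Prop :=
  exists (p : cmd) (c : nat),
  forall G : graph, is_graph directed weighted G ->
  forall w : nat, c * Nat.log2 (nverts G + max_weight G + 2) <= w ->
    runs w p (encode_graph weighted G) (g (nedges G) (nverts G))
      (fun out => forall x, x < nverts G ->
         exists e, is_ecc directed G x e /\ out x = encode_ext e).

(* The first argument of g is the number of edges, the second the number of
   vertices. *)
Definition sub_mn (g : nat -> nat -> R) : Prop :=
  exists alpha beta : R, (alpha + beta < 2)%R /\
  exists (C : R) (N : nat), forall m n : nat, N <= m -> N <= n ->
    (g m n <= C * (Rpower (INR m) alpha * Rpower (INR n) beta))%R.

(* Main.v *)
(** Split the [n] variables into two halves of [h = (n + 1) / 2] variables. The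
    vertices of the graph are the [2 * 2 ^ h] assignments of a half, the clauses,
    and one hub per half. An assignment is joined to the clauses it fails to
    satisfy and to the hub of its half; each hub is joined to all clauses and to
    the other hub. An assignment [u] of the first half is then at distance at most
    2 from every vertex outside the second half, and at distance 2 or 3 from an
    assignment [v] of the second half: 2 if and only if some clause is satisfied
    by neither, i.e. if and only if [u] and [v] together do not satisfy the
    formula. So the formula is satisfiable if and only if some [u] has
    eccentricity 3.

    A k-CNF has polynomially many distinct clauses, so both the numbers of
    vertices and of edges lie between [2 ^ h] and [2 ^ h * poly n]; a bound
    [m ^ alpha * n ^ beta] becomes [2 ^ ((alpha + beta) * n / 2)] up to a
    polynomial, which is [O(2 ^ (delta * n))] for some [delta < 1]. The word RAM
    program that writes down the graph runs in time [2 ^ h * poly n]; the given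
    eccentricity program is called on it with registers and arrays renamed. *)

From Stdlib Require Import Reals Arith List Bool Lia Lra.
Require Import Defs.
Import ListNotations.

(** * Renaming the registers and arrays of a program *)

Fixpoint rename (f g : nat -> nat) (p : cmd) : cmd :=
  match p with
  | Skip => Skip
  | Const x c => Const (f x) c
  | Op o x y z => Op o (f x) (f y) (f z)
  | Read x a y => Read (f x) (g a) (f y)
  | Write a x y => Write (g a) (f x) (f y)
  | Seq p q => Seq (rename f g p) (rename f g q)
  | If x p q => If (f x) (rename f g p) (rename f g q)
  | While x p => While (f x) (rename f g p)
  end.

(** Cells outside the images of [f] and [g] are unconstrained, so [s'] may hold other data besides
    the copy of [s]. *)
Definition embeds (f g : nat -> nat) (s s' : state) : Prop :=
  (forall x, reg s' (f x) = reg s x) /\ (forall a i, mem s' (g a) i = mem s a i).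

Lemma embeds_set_reg f g s s' x v :
  (forall x y, f x = f y -> x = y) -> embeds f g s s' ->
  embeds f g (set_reg s x v) (set_reg s' (f x) v).
Proof.
  intros Hf [Hr Hm]. split; [|exact Hm].
  intros y. unfold set_reg, upd. cbn.
  destruct (Nat.eqb_spec y x) as [->|Hn].
  - rewrite Nat.eqb_refl. reflexivity.
  - destruct (Nat.eqb_spec (f y) (f x)) as [E|_]; [|apply Hr].
    elim Hn. now apply Hf.
Qed.

Lemma embeds_set_mem f g s s' a i v :
  (forall x y, g x = g y -> x = y) -> embeds f g s s' ->
  embeds f g (set_mem s a i v) (set_mem s' (g a) i v).
Proof.
  intros Hg [Hr Hm]. split; [exact Hr|].
  intros b j. unfold set_mem, upd. cbn.
  destruct (Nat.eqb_spec b a) as [->|Hn].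
  - rewrite Nat.eqb_refl. destruct (j =? i); [reflexivity|apply Hm].
  - destruct (Nat.eqb_spec (g b) (g a)) as [E|_]; [|apply Hm].
    elim Hn. now apply Hg.
Qed.

(** Injectivity keeps distinct cells apart. The last conjunct lets a caller keep its variables in
    registers outside the image of [f] during a subroutine call. *)
Lemma exec_rename w f g p s t s1 :
  (forall x y, f x = f y -> x = y) -> (forall x y, g x = g y -> x = y) ->
  exec w p s t s1 ->
  forall s', embeds f g s s' ->
  exists s1', exec w (rename f g p) s' t s1' /\ embeds f g s1 s1' /\
    forall y, (forall x, y <> f x) -> reg s1' y = reg s' y.
Proof.
  intros Hf Hg He.
  assert (Hset : forall s' x v y, (forall x, y <> f x) ->
            reg (set_reg s' (f x) v) y = reg s' y).
  { intros s' x v y Hy. unfold set_reg, upd. cbn.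
    destruct (Nat.eqb_spec y (f x)) as [E|_]; [now elim (Hy x)|reflexivity]. }
  induction He; intros s0 Hs; cbn [rename].
  - exists s0. split; [constructor|]. now split.
  - eexists. split; [constructor|]. split; [now apply embeds_set_reg|apply Hset].
  - eexists. split; [constructor|]. split; [|apply Hset].
    rewrite !(proj1 Hs). now apply embeds_set_reg.
  - eexists. split; [constructor|]. split; [|apply Hset].
    rewrite (proj1 Hs), (proj2 Hs). now apply embeds_set_reg.
  - eexists. split; [constructor|]. split; [|reflexivity].
    rewrite !(proj1 Hs). now apply embeds_set_mem.
  - destruct (IHHe1 _ Hs) as (u1 & E1 & R1 & F1).
    destruct (IHHe2 _ R1) as (u2 & E2 & R2 & F2).
    exists u2. split; [now econstructor; eauto|]. split; [exact R2|].
    intros y Hy. now rewrite F2, F1.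
  - destruct (IHHe _ Hs) as (u1 & E1 & R1 & F1).
    exists u1. split; [|now split]. apply EIfTrue; [|exact E1].
    now rewrite (proj1 Hs).
  - destruct (IHHe _ Hs) as (u1 & E1 & R1 & F1).
    exists u1. split; [|now split]. apply EIfFalse; [|exact E1].
    now rewrite (proj1 Hs).
  - destruct (IHHe1 _ Hs) as (u1 & E1 & R1 & F1).
    destruct (IHHe2 _ R1) as (u2 & E2 & R2 & F2).
    exists u2. split.
    + eapply EWhileTrue; [now rewrite (proj1 Hs)|exact E1|exact E2].
    + split; [exact R2|]. intros y Hy. now rewrite F2, F1.
  - exists s0. split; [|now split]. apply EWhileFalse. now rewrite (proj1 Hs).
Qed.

(** * Boundedness of all words *)

Definition bounded (w : nat) (s : state) : Prop :=
  (forall x, reg s x < 2 ^ w) /\ (forall a i, mem s a i < 2 ^ w).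

Lemma trunc_lt w v : trunc w v < 2 ^ w.
Proof. apply Nat.mod_upper_bound, Nat.pow_nonzero. discriminate. Qed.

Lemma trunc_small w v : v < 2 ^ w -> trunc w v = v.
Proof. apply Nat.mod_small. Qed.

Lemma bounded_set_reg w s x v : bounded w s -> v < 2 ^ w -> bounded w (set_reg s x v).
Proof.
  intros [Hr Hm] Hv. split; [|exact Hm]. intros y. unfold set_reg, upd. cbn.
  destruct (y =? x); auto.
Qed.

Lemma bounded_set_mem w s a i v : bounded w s -> v < 2 ^ w -> bounded w (set_mem s a i v).
Proof.
  intros [Hr Hm] Hv. split; [exact Hr|]. intros b j. unfold set_mem, upd. cbn.
  destruct (b =? a); auto. destruct (j =? i); auto.
Qed.

(** Every new word is truncated or copied from another cell. The bound matters because moves are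
    made with [Or], which truncates. *)
Lemma exec_bounded w p s t s' : exec w p s t s' -> bounded w s -> bounded w s'.
Proof.
  intros He. induction He; intros Hb; auto.
  - apply bounded_set_reg; auto using trunc_lt.
  - apply bounded_set_reg; auto. apply trunc_lt.
  - apply bounded_set_reg; auto. apply Hb.
  - apply bounded_set_mem; auto. apply Hb.
Qed.

Lemma init_bounded w input : bounded w (init w input).
Proof.
  assert (0 < 2 ^ w) by (apply Nat.neq_0_lt_0, Nat.pow_nonzero; discriminate).
  split; cbn; [auto|]. intros a i. destruct (a =? input_array); auto using trunc_lt.
Qed.

(** * A small imperative language over the word RAM *)

Inductive expr : Set :=
  | Var (x : nat)
  | Num (c : nat)
  | Bin (o : binop) (a b : expr)
  | Get (a : nat) (e : expr).

Record store : Type := Store { vars : list nat; arrays : nat -> nat -> nat }.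

(* Variables and temporaries live in the odd registers: the even ones are left
   to the renamed subroutine. Registers [own x] with [nvar <= x] are
   temporaries. *)
Definition nvar : nat := 10.
Definition own (x : nat) : nat := 2 * x + 1.

Definition den_op (o : binop) (x y : nat) : nat :=
  match o with
  | Add => x + y
  | Sub => x - y
  | Mul => x * y
  | Div => x / y
  | Mod => x mod y
  | And => Nat.land x y
  | Or => Nat.lor x y
  | Xor => Nat.lxor x y
  | Shl => Nat.shiftl x y
  | Shr => Nat.shiftr x y
  | Ltb => Nat.b2n (x <? y)
  | Eqb => Nat.b2n (x =? y)
  end.

Fixpoint den (e : expr) (m : store) : nat :=
  match e with
  | Var x => nth x (vars m) 0
  | Num c => c
  | Bin o a b => den_op o (den a m) (den b m)
  | Get a e => arrays m a (den e m)
  end.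

(** When the truncated operation agrees with [den_op] on words. Quotients, remainders and right
    shifts never exceed [x]; a comparison needs room for one bit. *)
Definition op_exact (w : nat) (o : binop) (x y : nat) : Prop :=
  match o with
  | Sub => y <= x
  | Div | Mod | Shr => True
  | Ltb | Eqb => 0 < w
  | _ => den_op o x y < 2 ^ w
  end.

Fixpoint exact (w : nat) (e : expr) (m : store) : Prop :=
  match e with
  | Var x => x < nvar
  | Num c => c < 2 ^ w
  | Bin o a b => exact w a m /\ exact w b m /\ op_exact w o (den a m) (den b m)
  | Get a e => exact w e m
  end.

(* The RAM has no move instruction: [Or] of a register with itself serves as one. *)
Fixpoint eval_into (d : nat) (e : expr) : cmd :=
  match e with
  | Var x => Op Or (own d) (own x) (own x)
  | Num c => Const (own d) c
  | Bin o a b =>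
      Seq (eval_into d a) (Seq (eval_into (S d) b) (Op o (own d) (own d) (own (S d))))
  | Get a e => Seq (eval_into d e) (Read (own d) a (own d))
  end.

Fixpoint cost (e : expr) : nat :=
  match e with
  | Var _ | Num _ => 1
  | Bin _ a b => cost a + (cost b + 1)
  | Get _ e => cost e + 1
  end.

(** [z] records the even registers, which the code compiled here leaves alone; the registers of
    temporaries are free. *)
Definition represents (w : nat) (z : nat -> nat) (s : state) (m : store) : Prop :=
  bounded w s /\
  (forall x, x < nvar -> reg s (own x) = nth x (vars m) 0) /\
  (forall x, reg s (2 * x) = z x) /\
  (forall a i, mem s a i = arrays m a i).

Lemma eval_op_exact w o x y :
  x < 2 ^ w -> y < 2 ^ w -> op_exact w o x y -> eval_op w o x y = den_op o x y.
Proof.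
  intros Hx Hy Ho. unfold eval_op.
  assert (Hb : forall b, 0 < w -> Nat.b2n b < 2 ^ w).
  { intros b Hw. assert (2 ^ 1 <= 2 ^ w) by (apply Nat.pow_le_mono_r; lia).
    destruct b; cbn [Nat.b2n Nat.pow Nat.mul Nat.add] in *; lia. }
  destruct o; cbn [op_exact den_op] in *; try (apply trunc_small; auto; fail).
  - unfold trunc. replace (x + 2 ^ w - y) with (x - y + 1 * 2 ^ w) by lia.
    rewrite Nat.Div0.mod_add. apply Nat.mod_small. lia.
  (* [x / 0] is 0 and, in the next case, [x mod 0] is [x]; both are in range. *)
  - apply trunc_small. destruct y; [cbn; lia|].
    apply Nat.le_lt_trans with x; [|exact Hx]. apply Nat.Div0.div_le_upper_bound. lia.
  - apply trunc_small. destruct y; [exact Hx|].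
    apply Nat.le_lt_trans with x; [|exact Hx]. apply Nat.Div0.mod_le.
  - apply trunc_small. rewrite Nat.shiftr_div_pow2.
    apply Nat.le_lt_trans with x; [|exact Hx]. apply Nat.Div0.div_le_upper_bound.
    assert (2 ^ y <> 0) by (apply Nat.pow_nonzero; lia). nia.
Qed.

Lemma represents_set_temp w z s m d v :
  nvar <= d -> v < 2 ^ w -> represents w z s m -> represents w z (set_reg s (own d) v) m.
Proof.
  intros Hd Hv (Hb & Hr & Hz & Hm). split; [now apply bounded_set_reg|].
  split; [|split; [|exact Hm]]; intros x; [intros Hx|]; unfold set_reg, upd, own in *; cbn [reg].
  - destruct (Nat.eqb_spec (2 * x + 1) (2 * d + 1)); [lia|auto].
  - destruct (Nat.eqb_spec (2 * x) (2 * d + 1)); [lia|auto].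
Qed.

Lemma set_reg_same s x v : reg (set_reg s x v) x = v.
Proof. cbn. unfold upd. now rewrite Nat.eqb_refl. Qed.

Lemma set_reg_other s x v y : y <> x -> reg (set_reg s x v) y = reg s y.
Proof. intros H. cbn. unfold upd. now destruct (Nat.eqb_spec y x). Qed.

(** Temporaries form a stack: the left operand survives at level [d] while the right one is
    evaluated at [S d]. *)
Lemma exec_eval_into w z m e : forall d s,
  nvar <= d -> represents w z s m -> exact w e m ->
  exists s', exec w (eval_into d e) s (cost e) s' /\ represents w z s' m /\
    reg s' (own d) = den e m /\
    forall y, y < d -> reg s' (own y) = reg s (own y).
Proof.
  assert (Hother : forall s d v y, y < d -> reg (set_reg s (own d) v) (own y) = reg s (own y)).
  { intros. apply set_reg_other. unfold own. lia. }
  induction e as [x|c|o a IHa b IHb|a e IHe]; intros d s Hd Hs He; cbn [exact] in He;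
    cbn [eval_into cost den].
  - eexists. split; [constructor|].
    assert (E : eval_op w Or (reg s (own x)) (reg s (own x)) = nth x (vars m) 0).
    { pose proof (proj1 Hs) as [Hb _]. rewrite eval_op_exact; auto; cbn;
        rewrite Nat.lor_diag; auto. now apply Hs. }
    rewrite set_reg_same. split; [|split; [exact E|auto]].
    apply represents_set_temp; auto. apply trunc_lt.
  - eexists. split; [constructor|]. rewrite set_reg_same.
    split; [apply represents_set_temp; auto using trunc_lt|].
    split; [now apply trunc_small|auto].
  - destruct He as (Ha & Hb & Ho).
    destruct (IHa d s Hd Hs Ha) as (s1 & E1 & R1 & V1 & F1).
    destruct (IHb (S d) s1 (le_S _ _ Hd) R1 Hb) as (s2 & E2 & R2 & V2 & F2).
    eexists. split; [econstructor; [exact E1|econstructor; [exact E2|constructor]]|].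
    rewrite set_reg_same.
    split; [apply represents_set_temp; auto; apply trunc_lt|].
    split.
    + assert (W : reg s2 (own d) = den a m) by (rewrite F2, V1; auto).
      rewrite <- W, <- V2 in Ho |- *. apply eval_op_exact; auto; apply (proj1 R2).
    + intros y Hy. rewrite Hother, F2, F1; auto.
  - destruct (IHe d s Hd Hs He) as (s1 & E1 & R1 & V1 & F1).
    eexists. split; [econstructor; [exact E1|constructor]|].
    rewrite set_reg_same.
    split; [apply represents_set_temp; auto; apply (proj1 R1)|].
    split; [rewrite V1; apply R1|].
    intros y Hy. rewrite Hother; auto.
Qed.

(** * Statements and their time bounds *)

Definition Assign (x : nat) (e : expr) : cmd :=
  Seq (eval_into nvar e) (Op Or (own x) (own nvar) (own nvar)).

Definition Put (a : nat) (e1 e2 : expr) : cmd :=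
  Seq (eval_into nvar e1) (Seq (eval_into (S nvar) e2) (Write a (own nvar) (own (S nvar)))).

Definition Cond (e : expr) (p q : cmd) : cmd :=
  Seq (eval_into nvar e) (If (own nvar) p q).

(** [While] only tests a register, so the guard is evaluated before the loop and again after each
    pass. *)
Definition Loop (e : expr) (p : cmd) : cmd :=
  Seq (eval_into nvar e) (While (own nvar) (Seq p (eval_into nvar e))).

Fixpoint set_nth (x v : nat) (l : list nat) : list nat :=
  match x, l with
  | _, [] => []
  | 0, _ :: l => v :: l
  | S x, u :: l => u :: set_nth x v l
  end.

Lemma nth_set_nth x v l y :
  x < length l -> nth y (set_nth x v l) 0 = if y =? x then v else nth y l 0.
Proof.
  revert x y. induction l as [|u l IH]; intros [|x] [|y]; cbn; intros H; try lia; auto.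
  apply IH. lia.
Qed.

(** A total-correctness triple in which [t] only bounds the time; the temporaries of the initial
    state are arbitrary. *)
Definition computes (w : nat) (z : nat -> nat) (p : cmd) (m : store) (t : nat) (m' : store)
    : Prop :=
  forall s, represents w z s m ->
  exists t' s', exec w p s t' s' /\ t' <= t /\ represents w z s' m'.

Lemma computes_skip w z m : computes w z Skip m 1 m.
Proof. intros s Hs. exists 1, s. split; [constructor|auto]. Qed.

Lemma computes_seq w z p q m m1 m2 t1 t2 :
  computes w z p m t1 m1 -> computes w z q m1 t2 m2 ->
  computes w z (Seq p q) m (t1 + t2) m2.
Proof.
  intros Hp Hq s Hs.
  destruct (Hp s Hs) as (u1 & s1 & E1 & L1 & R1).
  destruct (Hq s1 R1) as (u2 & s2 & E2 & L2 & R2).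
  exists (u1 + u2), s2. split; [econstructor; eauto|]. split; [lia|exact R2].
Qed.

Lemma computes_weaken w z p m t m' t' m'' :
  computes w z p m t m' -> t <= t' -> vars m' = vars m'' ->
  (forall a i, arrays m' a i = arrays m'' a i) ->
  computes w z p m t' m''.
Proof.
  intros Hp Ht Hv Ha s Hs. destruct (Hp s Hs) as (u & s1 & E & L & R1 & R2 & R3 & R4).
  exists u, s1. split; [exact E|]. split; [lia|].
  split; [exact R1|]. rewrite <- Hv. split; [exact R2|]. split; [exact R3|].
  intros a i. now rewrite <- Ha.
Qed.

Lemma computes_assign w z x e m :
  x < nvar -> length (vars m) = nvar -> exact w e m ->
  computes w z (Assign x e) m (cost e + 1) (Store (set_nth x (den e m) (vars m)) (arrays m)).
Proof.
  intros Hx Hl He s Hs.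
  destruct (exec_eval_into w z m e nvar s (le_n _) Hs He) as (s1 & E1 & R1 & V1 & _).
  eexists _, _. split; [econstructor; [exact E1|constructor]|]. split; [lia|].
  assert (Hd : reg s1 (own nvar) < 2 ^ w) by apply (proj1 R1).
  rewrite eval_op_exact; cbn [op_exact den_op]; rewrite ?Nat.lor_diag; auto.
  rewrite V1 in Hd |- *. destruct R1 as (Hb & Hr & Hz & Hm).
  split; [now apply bounded_set_reg|]. cbn [vars arrays].
  split; [|split; [|exact Hm]]; intros y; [intros Hy|];
    unfold set_reg, upd, own in *; cbn [reg].
  - rewrite nth_set_nth by lia.
    destruct (Nat.eqb_spec (2 * y + 1) (2 * x + 1)), (Nat.eqb_spec y x); try lia; auto.
  - destruct (Nat.eqb_spec (2 * y) (2 * x + 1)); [lia|auto].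
Qed.

Lemma computes_put w z a e1 e2 m :
  exact w e1 m -> exact w e2 m ->
  computes w z (Put a e1 e2) m (cost e1 + (cost e2 + 1))
    (Store (vars m) (upd (arrays m) a (upd (arrays m a) (den e1 m) (den e2 m)))).
Proof.
  intros H1 H2 s Hs.
  destruct (exec_eval_into w z m e1 nvar s (le_n _) Hs H1) as (s1 & E1 & R1 & V1 & _).
  destruct (exec_eval_into w z m e2 (S nvar) s1 (le_S _ _ (le_n _)) R1 H2)
    as (s2 & E2 & R2 & V2 & F2).
  eexists _, _. split; [econstructor; [exact E1|econstructor; [exact E2|constructor]]|].
  split; [lia|]. rewrite F2, V1, V2 by auto.
  pose proof (proj1 (proj1 R2) (own (S nvar))) as Hd. rewrite V2 in Hd.
  destruct R2 as (Hb & Hr & Hz & Hm).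
  split; [now apply bounded_set_mem|]. split; [exact Hr|]. split; [exact Hz|].
  intros b i. unfold set_mem, upd. cbn [mem arrays].
  destruct (b =? a); auto. destruct (i =? den e1 m); auto.
Qed.

Lemma computes_cond w z e p q m t m' :
  exact w e m ->
  (den e m <> 0 -> computes w z p m t m') ->
  (den e m = 0 -> computes w z q m t m') ->
  computes w z (Cond e p q) m (cost e + S t) m'.
Proof.
  intros He Hp Hq s Hs.
  destruct (exec_eval_into w z m e nvar s (le_n _) Hs He) as (s1 & E1 & R1 & V1 & _).
  destruct (Nat.eq_dec (den e m) 0) as [Z|Z].
  - destruct (Hq Z s1 R1) as (u & s2 & E2 & L2 & R2).
    exists (cost e + S u), s2. split; [|split; [lia|exact R2]].
    econstructor; [exact E1|]. apply EIfFalse; [congruence|exact E2].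
  - destruct (Hp Z s1 R1) as (u & s2 & E2 & L2 & R2).
    exists (cost e + S u), s2. split; [|split; [lia|exact R2]].
    econstructor; [exact E1|]. apply EIfTrue; [congruence|exact E2].
Qed.

(** The sequence [m] takes the place of an invariant: [m i] is the store after [i] passes. A pass
    costs the body, the next evaluation of the guard and a test; the last terms are the first
    evaluation and the failing test. *)
Lemma computes_loop w z e p t k : forall m : nat -> store,
  (forall i, i <= k -> exact w e (m i)) ->
  (forall i, i < k -> den e (m i) <> 0) ->
  den e (m k) = 0 ->
  (forall i, i < k -> computes w z p (m i) t (m (S i))) ->
  computes w z (Loop e p) (m 0) (k * (t + cost e + 1) + cost e + 1) (m k).
Proof.
  intros m He Hn Hz Hp s Hs.
  destruct (exec_eval_into w z _ e nvar s (le_n _) Hs (He 0 (Nat.le_0_l _)))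
    as (s1 & E1 & R1 & V1 & _).
  (* With the first evaluation of the guard split off, the induction speaks of the bare [While],
     entered with the guard already in its register. *)
  enough (H : exists t' s', exec w (While (own nvar) (Seq p (eval_into nvar e))) s1 t' s' /\
            t' <= k * (t + cost e + 1) + 1 /\ represents w z s' (m k)).
  { destruct H as (u & s2 & E2 & L2 & R2). exists (cost e + u), s2.
    split; [econstructor; eauto|]. split; [lia|exact R2]. }
  clear s Hs E1. revert m s1 He Hn Hz Hp R1 V1.
  induction k as [|k IH]; intros m s He Hn Hz Hp R1 V1.
  - exists 1, s. split; [apply EWhileFalse; congruence|]. split; [lia|exact R1].
  - destruct (Hp 0 (Nat.lt_0_succ _) s R1) as (u & s2 & E2 & L2 & R2).
    destruct (exec_eval_into w z _ e nvar s2 (le_n _) R2 (He 1 ltac:(lia)))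
      as (s3 & E3 & R3 & V3 & _).
    destruct (IH (fun i => m (S i)) s3) as (v & s4 & E4 & L4 & R4); auto.
    + intros i Hi. apply He. lia.
    + intros i Hi. apply Hn. lia.
    + intros i Hi. apply Hp. lia.
    + exists (S ((u + cost e) + v)), s4. split; [|split; [lia|exact R4]].
      eapply EWhileTrue; [|econstructor; [exact E2|exact E3]|exact E4].
      rewrite V1. apply Hn. lia.
Qed.

(** * The graph of a formula *)

Lemma length_flat_map_le {A B : Type} (f : A -> list B) c l :
  (forall x, In x l -> length (f x) <= c) -> length (flat_map f l) <= length l * c.
Proof.
  induction l as [|x l IH]; cbn [flat_map length]; intros H; [lia|].
  rewrite length_app.
  pose proof (H x (or_introl eq_refl)). specialize (IH (fun y Hy => H y (or_intror Hy))). lia.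
Qed.

Lemma length_flat_map_ge {A B : Type} (f : A -> list B) c l :
  (forall x, In x l -> c <= length (f x)) -> length l * c <= length (flat_map f l).
Proof.
  induction l as [|x l IH]; cbn [flat_map length]; intros H; [lia|].
  rewrite length_app.
  pose proof (H x (or_introl eq_refl)). specialize (IH (fun y Hy => H y (or_intror Hy))). lia.
Qed.

Lemma flat_map_flat_map {A B C : Type} (f : A -> list B) (g : B -> list C) l :
  flat_map g (flat_map f l) = flat_map (fun x => flat_map g (f x)) l.
Proof. induction l as [|x l IH]; cbn; [reflexivity|]. now rewrite flat_map_app, IH. Qed.

Lemma NoDup_flat_map {A B : Type} (f : A -> list B) l :
  NoDup l -> (forall x, In x l -> NoDup (f x)) ->
  (forall x y b, In x l -> In y l -> In b (f x) -> In b (f y) -> x = y) ->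
  NoDup (flat_map f l).
Proof.
  induction 1 as [|x l Hx Hl IH]; cbn; intros Hf Hd; [constructor|].
  apply NoDup_app; [auto| |].
  - apply IH; [auto|]. intros. eapply Hd; eauto.
  - intros b Hb Hb'. apply in_flat_map in Hb' as (y & Hy & Hby). elim Hx.
    rewrite (Hd x y b); auto.
Qed.

(* A number [s < 2 * 2 ^ h] is a partial assignment: bit [h] tells which half of
   the variables it assigns, the lower bits are the values. *)
Definition lit_true (h s : nat) (l : literal) : bool :=
  (fst l / h =? s / 2 ^ h) && Bool.eqb (Nat.testbit s (fst l mod h)) (snd l).

(** Literals over the other half are never [lit_true], so a clause with no variable in the half of
    [s] is falsified by [s]. *)
Definition falsifies (h s : nat) (C : clause) : bool := negb (existsb (lit_true h s) C).

Definition conflict_pairs (h s : nat) (Cs : list clause) (j : nat) : list (nat * nat) :=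
  if falsifies h s (nth j Cs []) then [(s, 2 * 2 ^ h + j)] else [].

(* Vertices: partial assignments below [2 * 2 ^ h], then the clauses, then one
   hub for each half of the variables. *)
Definition assignment_pairs (h : nat) (Cs : list clause) (s : nat) : list (nat * nat) :=
  flat_map (conflict_pairs h s Cs) (seq 0 (length Cs)) ++
  [(s, 2 * 2 ^ h + length Cs + s / 2 ^ h)].

Definition clause_pairs (h M j : nat) : list (nat * nat) :=
  [(2 * 2 ^ h + j, 2 * 2 ^ h + M); (2 * 2 ^ h + j, 2 * 2 ^ h + M + 1)].

Definition pairs (h : nat) (Cs : list clause) : list (nat * nat) :=
  flat_map (assignment_pairs h Cs) (seq 0 (2 * 2 ^ h)) ++
  flat_map (clause_pairs h (length Cs)) (seq 0 (length Cs)) ++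
  [(2 * 2 ^ h + length Cs, 2 * 2 ^ h + length Cs + 1)].

(** Weight 1 throughout and, for directed graphs, both directions of each edge: distances are the
    same in all four settings. *)
Definition orient (directed : bool) (e : nat * nat) : list (nat * nat * nat) :=
  (e, 1) :: if directed then [((snd e, fst e), 1)] else [].

Definition sat_graph (directed : bool) (h : nat) (Cs : list clause) : graph :=
  Graph (2 * 2 ^ h + length Cs + 2) (flat_map (orient directed) (pairs h Cs)).

Lemma pow2_pos h : 0 < 2 ^ h.
Proof. apply Nat.neq_0_lt_0, Nat.pow_nonzero. discriminate. Qed.

Lemma half_cases N s : s < 2 * N -> (s / N = 0 /\ s < N) \/ (s / N = 1 /\ N <= s).
Proof.
  intros H. destruct (Nat.lt_ge_cases s N) as [L|L]; [left|right]; split; auto.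
  - now apply Nat.div_small.
  - symmetry. apply Nat.div_unique with (s - N); lia.
Qed.

Section SatGraph.

Variables (h : nat) (Cs : list clause).
Let N := 2 ^ h.
Let M := length Cs.

Lemma N_pos : 0 < N.
Proof. apply pow2_pos. Qed.

Lemma in_conflict_pairs s j u v :
  In (u, v) (conflict_pairs h s Cs j) <->
  u = s /\ v = 2 * N + j /\ falsifies h s (nth j Cs []) = true.
Proof.
  unfold conflict_pairs. fold N.
  destruct (falsifies h s (nth j Cs [])); cbn [In].
  - split; [intros [[= <- <-]|[]]; auto|intros (-> & -> & _); auto].
  - split; [intros []|intros (_ & _ & [=])].
Qed.

Lemma in_assignment_pairs s u v :
  In (u, v) (assignment_pairs h Cs s) <->
  u = s /\ ((exists j, j < M /\ v = 2 * N + j /\ falsifies h s (nth j Cs []) = true) \/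
            v = 2 * N + M + s / N).
Proof.
  unfold assignment_pairs. fold N M. rewrite in_app_iff, in_flat_map. split.
  - intros [(j & Hj & H)|[[= <- <-]|[]]]; [|auto].
    apply in_seq in Hj. apply in_conflict_pairs in H as (-> & -> & H).
    split; [auto|left]. exists j. split; [lia|auto].
  - intros [-> [(j & Hj & -> & H)| ->]]; [left|right; now left].
    exists j. split; [apply in_seq; lia|]. now apply in_conflict_pairs.
Qed.

Lemma in_pairs u v :
  In (u, v) (pairs h Cs) <->
  (u < 2 * N /\ exists j, j < M /\ v = 2 * N + j /\ falsifies h u (nth j Cs []) = true) \/
  (u < 2 * N /\ v = 2 * N + M + u / N) \/
  (exists j, j < M /\ u = 2 * N + j /\ (v = 2 * N + M \/ v = 2 * N + M + 1)) \/
  (u = 2 * N + M /\ v = 2 * N + M + 1).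
Proof.
  unfold pairs. fold N M. rewrite !in_app_iff, !in_flat_map. split.
  - intros [(s & Hs & H)|[(j & Hj & H)|[[= <- <-]|[]]]]; auto.
    + apply in_seq in Hs. apply in_assignment_pairs in H as (-> & [H|H]); [left|right; left];
        split; auto; lia.
    + right; right; left. apply in_seq in Hj. exists j. split; [lia|].
      destruct H as [[= <- <-]|[[= <- <-]|[]]]; auto.
  - intros [(Hu & H)|[(Hu & ->)|[(j & Hj & -> & [-> | ->])|[-> ->]]]].
    + left. exists u. split; [apply in_seq; lia|]. apply in_assignment_pairs. auto.
    + left. exists u. split; [apply in_seq; lia|]. apply in_assignment_pairs. auto.
    + right; left. exists j. split; [apply in_seq; lia|]. now left.
    + right; left. exists j. split; [apply in_seq; lia|]. right; now left.
    + right; right. now left.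
Qed.

(** Listing the smaller endpoint first excludes loops and ensures that no pair also occurs
    reversed. *)
Lemma pairs_range u v : In (u, v) (pairs h Cs) -> u < v /\ v < 2 * N + M + 2.
Proof.
  intros H. apply in_pairs in H.
  destruct H as [(Hu & j & Hj & -> & _)|[(Hu & ->)|[(j & Hj & -> & [-> | ->])|[-> ->]]]]; try lia.
  destruct (half_cases N u Hu) as [[-> ?]|[-> ?]]; lia.
Qed.

(** First components separate the three blocks and, inside them, the different assignments and
    clauses; pairs with the same first component differ in the second. *)
Lemma NoDup_pairs : NoDup (pairs h Cs).
Proof.
  unfold pairs. fold N M. apply NoDup_app; [|apply NoDup_app|].
  - apply NoDup_flat_map; [apply seq_NoDup| |].
    + intros s _. unfold assignment_pairs. fold N M.
      apply NoDup_app; [|repeat constructor; intros []|].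
      * apply NoDup_flat_map; [apply seq_NoDup| |].
        -- intros j _. unfold conflict_pairs.
           destruct (falsifies h s (nth j Cs [])); repeat constructor; intros [].
        -- intros i j [u v] _ _ H1 H2.
           apply in_conflict_pairs in H1 as (_ & ? & _), H2 as (_ & ? & _). lia.
      * intros [u v] H [[= <- <-]|[]].
        apply in_flat_map in H as (j & Hj & H). apply in_seq in Hj.
        apply in_conflict_pairs in H as (_ & ? & _). lia.
    + intros s t [u v] _ _ H1 H2.
      apply in_assignment_pairs in H1 as [? _], H2 as [? _]. congruence.
  - apply NoDup_flat_map; [apply seq_NoDup| |].
    + intros j _. unfold clause_pairs. fold N.
      constructor; [|repeat constructor; intros []]. intros [E|[]]; injection E; lia.
    + intros i j [u v] _ _ H1 H2. unfold clause_pairs in *.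
      destruct H1 as [[= ? ?]|[[= ? ?]|[]]], H2 as [[= ? ?]|[[= ? ?]|[]]]; lia.
  - repeat constructor. intros [].
  - intros [u v] H [[= <- <-]|[]]. apply in_flat_map in H as (j & Hj & H).
    apply in_seq in Hj. destruct H as [E|[E|[]]]; injection E; fold N M; lia.
  - intros [u v] H H'. apply in_flat_map in H as (s & Hs & H).
    apply in_seq in Hs. apply in_assignment_pairs in H as [-> _].
    apply in_app_iff in H' as [H'|[E|[]]]; [|injection E; lia].
    apply in_flat_map in H' as (j & Hj & H'). destruct H' as [E|[E|[]]];
      injection E; fold N M; lia.
Qed.

Lemma in_orient directed u v c e :
  In (u, v, c) (orient directed e) <->
  c = 1 /\ (e = (u, v) \/ (directed = true /\ e = (v, u))).
Proof.
  destruct e as [a b]. unfold orient. cbn [fst snd In]. split.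
  - intros [[= <- <- <-]|H]; [auto|]. destruct directed; [|destruct H].
    destruct H as [[= <- <- <-]|[]]. auto.
  - intros (-> & [[= <- <-]|[-> [= <- <-]]]); [now left|right; now left].
Qed.

Lemma in_edges directed u v c :
  In (u, v, c) (edges (sat_graph directed h Cs)) <->
  c = 1 /\ (In (u, v) (pairs h Cs) \/ (directed = true /\ In (v, u) (pairs h Cs))).
Proof.
  cbn [edges sat_graph]. rewrite in_flat_map. split.
  - intros (e & He & H). apply in_orient in H as (-> & [-> |[-> ->]]); auto.
  - intros (-> & [H|[-> H]]); [exists (u, v)|exists (v, u)]; rewrite in_orient; auto.
Qed.

Lemma in_arcs directed u v c :
  arc directed (sat_graph directed h Cs) u v c <->
  c = 1 /\ (In (u, v) (pairs h Cs) \/ In (v, u) (pairs h Cs)).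
Proof.
  unfold arc. rewrite !in_edges. destruct directed; intuition discriminate.
Qed.

Lemma sat_graph_is_graph directed weighted : is_graph directed weighted (sat_graph directed h Cs).
Proof.
  assert (Hfst : forall u v, In (u, v) (map fst (edges (sat_graph directed h Cs))) ->
            exists c, In (u, v, c) (edges (sat_graph directed h Cs))).
  { intros u v H. apply in_map_iff in H as ([[a b] c] & [= -> ->] & H). eauto. }
  split; [|split].
  - cbn [edges sat_graph]. rewrite flat_map_concat_map, concat_map, map_map, <- flat_map_concat_map.
    apply NoDup_flat_map; [apply NoDup_pairs| |].
    + intros [u v] H. apply pairs_range in H. destruct directed; cbn; [|repeat constructor; intros []].
      constructor; [|repeat constructor; intros []]. intros [E|[]]; injection E; lia.
    + intros [u v] [u' v'] [a b] H H' Hm Hm'.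
      apply in_map_iff in Hm as ([[? ?] c] & [= -> ->] & Hm).
      apply in_map_iff in Hm' as ([[? ?] c'] & [= -> ->] & Hm').
      apply pairs_range in H, H'.
      apply in_orient in Hm as (_ & [[= -> ->]|[_ [= -> ->]]]),
        Hm' as (_ & [[= -> ->]|[_ [= -> ->]]]); auto; lia.
  - intros u v c H. apply in_edges in H as (-> & H). cbn [nverts sat_graph]. fold N M.
    destruct H as [H|[_ H]]; apply pairs_range in H; lia.
  - intros -> u v H H'. apply Hfst in H as [c H], H' as [c' H'].
    apply in_edges in H as (_ & [H|[[=] _]]), H' as (_ & [H'|[[=] _]]).
    apply pairs_range in H, H'. lia.
Qed.

Definition adjacent u v := In (u, v) (pairs h Cs) \/ In (v, u) (pairs h Cs).

Lemma walk1 directed u v : adjacent u v -> walk directed (sat_graph directed h Cs) u v 1.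
Proof.
  intros H. change 1 with (1 + 0). eapply WalkCons; [|apply WalkNil]. apply in_arcs. auto.
Qed.

Lemma walk_step directed u v y l :
  adjacent u v -> walk directed (sat_graph directed h Cs) v y l ->
  walk directed (sat_graph directed h Cs) u y (S l).
Proof. intros H Hw. change (S l) with (1 + l). eapply WalkCons; [|exact Hw]. apply in_arcs. auto. Qed.

Lemma walk_inv directed u y l :
  walk directed (sat_graph directed h Cs) u y l ->
  (l = 0 /\ u = y) \/
  (exists v l', l = S l' /\ adjacent u v /\ walk directed (sat_graph directed h Cs) v y l').
Proof.
  intros H. inversion H; subst; [auto|]. right.
  apply in_arcs in H0 as [-> H0]. exists v, l0. auto.
Qed.

(** An assignment is always the smaller endpoint of its edges, so a pair with [s] in second place is
    impossible. *)
Lemma adjacent_assignment s v :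
  s < 2 * N -> adjacent s v ->
  (exists j, j < M /\ v = 2 * N + j /\ falsifies h s (nth j Cs []) = true) \/
  v = 2 * N + M + s / N.
Proof.
  intros Hs [H|H]; apply in_pairs in H.
  - destruct H as [[_ H]|[[_ H]|[(j & Hj & -> & _)|[-> _]]]]; auto; lia.
  - destruct H as [(_ & j & Hj & -> & _)|[[Hu ->]|[(j & Hj & -> & [-> | ->])|[-> ->]]]]; lia.
Qed.

Lemma adjacent_sym u v : adjacent u v -> adjacent v u.
Proof. unfold adjacent. tauto. Qed.

(** * Eccentricities of the assignments of the first half *)

Section Eccentricity.

Variables (directed : bool) (u : nat).
Hypothesis u_lt : u < N.

Lemma half_first : u / N = 0.
Proof. now apply Nat.div_small. Qed.

Lemma half_second v : N <= v < 2 * N -> v / N = 1.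
Proof. intros H. destruct (half_cases N v) as [[_ ?]|[? _]]; lia. Qed.

Lemma adjacent_first_hub s : s < N -> adjacent s (2 * N + M).
Proof.
  intros H. left. apply in_pairs. right; left. split; [lia|].
  rewrite (Nat.div_small s N H). lia.
Qed.

(** The hub [2 * N + M] of the first half is a neighbour of every vertex but itself and the
    assignments of the second half. *)
Lemma walk_near y :
  y < 2 * N + M + 2 -> ~ (N <= y < 2 * N) ->
  exists l, l <= 2 /\ walk directed (sat_graph directed h Cs) u y l.
Proof.
  intros Hy Hn. pose proof (adjacent_first_hub u u_lt) as Hu.
  destruct (Nat.eq_dec y (2 * N + M)) as [-> |H1].
  { exists 1. split; [lia|]. now apply walk1. }
  exists 2. split; [lia|]. apply walk_step with (2 * N + M); [exact Hu|]. apply walk1.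
  destruct (Nat.lt_ge_cases y N) as [H2|H2]; [now apply adjacent_sym, adjacent_first_hub|].
  destruct (Nat.lt_ge_cases y (2 * N + M)) as [H3|H3].
  - right. apply in_pairs. right; right; left. exists (y - 2 * N). lia.
  - left. apply in_pairs. right; right; right. lia.
Qed.

Lemma walk_far v :
  N <= v < 2 * N -> walk directed (sat_graph directed h Cs) u v 3.
Proof.
  intros Hv. apply walk_step with (2 * N + M); [now apply adjacent_first_hub|].
  apply walk_step with (2 * N + M + 1).
  - left. apply in_pairs. right; right; right. auto.
  - apply walk1. right. apply in_pairs. right; left. split; [lia|].
    rewrite (half_second v Hv). reflexivity.
Qed.

Lemma walk_conflict v j :
  N <= v < 2 * N -> j < M ->
  falsifies h u (nth j Cs []) = true -> falsifies h v (nth j Cs []) = true ->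
  walk directed (sat_graph directed h Cs) u v 2.
Proof.
  intros Hv Hj Hfu Hfv. apply walk_step with (2 * N + j); [left|apply walk1; right];
    apply in_pairs; left; (split; [lia|]); exists j; auto.
Qed.

Lemma short_walk_conflict v l :
  N <= v < 2 * N -> l <= 2 -> walk directed (sat_graph directed h Cs) u v l ->
  exists j, j < M /\ falsifies h u (nth j Cs []) = true /\ falsifies h v (nth j Cs []) = true.
Proof.
  intros Hv Hl Hw.
  apply walk_inv in Hw as [[_ <-]|(a & l1 & -> & H1 & Hw)]; [lia|].
  apply adjacent_assignment in H1; [|lia].
  apply walk_inv in Hw as [[_ <-]|(b & l2 & -> & H2 & Hw)].
  { destruct H1 as [(j & Hj & -> & _)| ->]; lia. }
  apply walk_inv in Hw as [[_ ->]|(c & l3 & -> & H3 & Hw)]; [|lia].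
  apply adjacent_sym, adjacent_assignment in H2; [|lia].
  (* The two assignments are attached to different hubs, so the middle vertex of the walk is a
     clause. *)
  rewrite half_first in H1. rewrite (half_second v Hv) in H2.
  destruct H1 as [(j & Hj & -> & Hf)| ->], H2 as [(j' & Hj' & E & Hf')|E]; try lia.
  assert (j' = j) as -> by lia. eauto.
Qed.

(** All vertices are within distance 3 of [u], and only a second-half assignment that shares no
    falsified clause with [u] is not within distance 2. *)
Lemma ecc_three e :
  is_ecc directed (sat_graph directed h Cs) u e ->
  (e = Some 3 <->
   exists v, N <= v < 2 * N /\
     forall j, j < M -> falsifies h u (nth j Cs []) = true ->
       falsifies h v (nth j Cs []) = true -> False).
Proof.
  intros [(y & Hy & Hd) Hmax]. cbn [nverts sat_graph] in Hy, Hmax. fold N M in Hy, Hmax.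
  assert (Hwalk : exists l, l <= 3 /\ walk directed (sat_graph directed h Cs) u y l).
  { assert (N <= y < 2 * N \/ ~ (N <= y < 2 * N)) as [H|H] by lia.
    - exists 3. split; [lia|]. now apply walk_far.
    - destruct (walk_near y Hy H) as (l & Hl & Hw). exists l. split; [lia|exact Hw]. }
  split.
  - intros ->. destruct Hd as [_ Hmin].
    assert (N <= y < 2 * N \/ ~ (N <= y < 2 * N)) as [H|H] by lia.
    + exists y. split; [exact H|]. intros j Hj Hu Hv.
      specialize (Hmin 2 (walk_conflict y j H Hj Hu Hv)). lia.
    + destruct (walk_near y Hy H) as (l & Hl & Hw). specialize (Hmin l Hw). lia.
  - intros (v & Hv & Hgood).
    assert (H3 : ext_le (Some 3) e).
    { apply (Hmax v); [lia|]. split; [now apply walk_far|].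
      intros l Hw. destruct (Nat.le_gt_cases 3 l) as [|Hl]; [assumption|].
      destruct (short_walk_conflict v l Hv ltac:(lia) Hw) as (j & Hj & H1 & H2).
      now elim (Hgood j Hj). }
    destruct Hwalk as (l & Hl & Hw).
    destruct e as [d|]; [|now elim (Hd l)]. destruct Hd as [_ Hmin].
    specialize (Hmin l Hw). cbn in H3. f_equal. lia.
Qed.

End Eccentricity.

(** * Weights and number of edges *)

Lemma max_weight_sat_graph directed : max_weight (sat_graph directed h Cs) <= 1.
Proof.
  unfold max_weight. apply list_max_le, Forall_forall. intros c H.
  apply in_map_iff in H as ([[a b] c'] & <- & H). apply in_edges in H as [-> _]. reflexivity.
Qed.

Lemma length_orient directed e : 1 <= length (orient directed e) <= 2.
Proof. unfold orient. destruct directed; cbn; lia. Qed.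

Lemma length_conflict_pairs s j : length (conflict_pairs h s Cs j) <= 1.
Proof. unfold conflict_pairs. destruct (falsifies h s (nth j Cs [])); cbn; lia. Qed.

Lemma length_assignment_pairs s : length (assignment_pairs h Cs s) <= M + 1.
Proof.
  unfold assignment_pairs. rewrite length_app. fold M.
  pose proof (length_flat_map_le (conflict_pairs h s Cs) 1 (seq 0 M)
                (fun j _ => length_conflict_pairs s j)) as H.
  rewrite length_seq in H. cbn. lia.
Qed.

Lemma length_pairs : 2 * N <= length (pairs h Cs) <= 2 * N * (M + 1) + M * 2 + 1.
Proof.
  assert (Ha : forall s, 1 <= length (assignment_pairs h Cs s))
    by (intros s; unfold assignment_pairs; rewrite length_app; cbn; lia).
  unfold pairs. rewrite !length_app. cbn [length]. fold N M.
  pose proof (length_flat_map_ge (assignment_pairs h Cs) 1 (seq 0 (2 * N)) (fun s _ => Ha s)).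
  pose proof (length_flat_map_le (assignment_pairs h Cs) (M + 1) (seq 0 (2 * N))
                (fun s _ => length_assignment_pairs s)).
  pose proof (length_flat_map_le (clause_pairs h M) 2 (seq 0 M) (fun s _ => le_n _)).
  rewrite length_seq in *. lia.
Qed.

(** The hub edges of the assignments give the lower bound, which matters when an exponent in the
    time bound is negative. *)
Lemma nedges_sat_graph directed :
  N <= nedges (sat_graph directed h Cs) <= N * (8 * (M + 1)).
Proof.
  unfold nedges. cbn [edges sat_graph]. pose proof length_pairs.
  pose proof (length_flat_map_ge (orient directed) 1 (pairs h Cs)
                (fun e _ => proj1 (length_orient directed e))).
  pose proof (length_flat_map_le (orient directed) 2 (pairs h Cs)
                (fun e _ => proj2 (length_orient directed e))).
  pose proof N_pos. nia.
Qed.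

End SatGraph.

(** * Satisfiability in terms of the two halves *)

Lemma nat_of_bits (f : nat -> bool) h :
  exists u, u < 2 ^ h /\ forall i, i < h -> Nat.testbit u i = f i.
Proof.
  revert f. induction h as [|h IH]; intros f; [exists 0; cbn; split; [lia|intros; lia]|].
  destruct (IH (fun i => f (S i))) as (u & Hu & Hb).
  exists (2 * u + Nat.b2n (f 0)). split.
  - cbn [Nat.pow]. destruct (f 0); cbn [Nat.b2n]; lia.
  - intros [|i] Hi; [apply Nat.testbit_0_r|].
    rewrite Nat.testbit_succ_r. apply Hb. lia.
Qed.

Lemma satisfiable_iff_halves F h :
  nvars F <= 2 * h ->
  (forall C, In C (clauses F) -> forall l, In l C -> fst l < nvars F) ->
  (satisfiable F <->
   exists u v, u < 2 ^ h /\ 2 ^ h <= v < 2 * 2 ^ h /\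
     forall j, j < length (clauses F) ->
       falsifies h u (nth j (clauses F) []) = true ->
       falsifies h v (nth j (clauses F) []) = true -> False).
Proof.
  intros Hh Hvar. pose proof (pow2_pos h) as HN.
  (* A variable exists only if [h] is nonzero, so quotients and remainders by [h] have their usual
     meaning here. *)
  assert (Hdiv : forall x, x < nvars F -> h <> 0 /\ x mod h < h /\
            ((x < h /\ x / h = 0 /\ x mod h = x) \/
             (h <= x /\ x / h = 1 /\ x mod h = x - h))).
  { intros x Hx. assert (h <> 0) by lia. split; [assumption|].
    split; [now apply Nat.mod_upper_bound|].
    pose proof (Nat.div_mod_eq x h). pose proof (Nat.mod_upper_bound x h H).
    destruct (half_cases h x) as [[E ?]|[E ?]]; [lia| |]; rewrite E in *; [left|right]; lia. }
  split.
  - intros [a Ha].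
    destruct (nat_of_bits a h) as (u & Hu & Bu).
    destruct (nat_of_bits (fun i => a (i + h)) h) as (v & Hv & Bv).
    (* Adding [2 ^ h] sets bit [h], the mark of the second half. *)
    exists u, (v + 1 * 2 ^ h). split; [exact Hu|]. split; [lia|].
    intros j Hj Fu Fv.
    assert (HC : In (nth j (clauses F) []) (clauses F)) by now apply nth_In.
    destruct (Ha _ HC) as (l & Hl & Hal). pose proof (Hvar _ HC l Hl) as Hx.
    destruct (Hdiv _ Hx) as (Hh0 & Hm & [(Hlt & Hd & Hmd)|(Hge & Hd & Hmd)]).
    + apply negb_true_iff in Fu. enough (existsb (lit_true h u) (nth j (clauses F) []) = true)
        by congruence.
      apply existsb_exists. exists l. split; [exact Hl|]. unfold lit_true.
      rewrite Hd, Hmd, (Nat.div_small u), Bu, Hal by assumption.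
      cbn. apply eqb_reflx.
    + apply negb_true_iff in Fv.
      enough (existsb (lit_true h (v + 1 * 2 ^ h)) (nth j (clauses F) []) = true) by congruence.
      apply existsb_exists. exists l. split; [exact Hl|]. unfold lit_true.
      rewrite Hd, Nat.div_add, (Nat.div_small v) by lia.
      rewrite <- (Nat.mod_pow2_bits_low _ h) by assumption.
      rewrite Nat.Div0.mod_add, Nat.mod_small, Hmd, Bv by lia.
      replace (fst l - h + h) with (fst l) by lia. rewrite Hal. cbn. apply eqb_reflx.
  - intros (u & v & Hu & Hv & Hgood).
    exists (fun x => Nat.testbit (if x <? h then u else v) (x mod h)).
    intros C HC. destruct (In_nth (A := clause) _ _ [] HC) as (j & Hj & EC).
    specialize (Hgood j Hj). rewrite EC in Hgood.
    assert (Hs : existsb (lit_true h u) C = true \/ existsb (lit_true h v) C = true).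
    { unfold falsifies in Hgood.
      destruct (existsb (lit_true h u) C); auto. destruct (existsb (lit_true h v) C); auto. }
    assert (Hv1 : v / 2 ^ h = 1) by (destruct (half_cases (2 ^ h) v) as [[? ?]|[? ?]]; lia).
    destruct Hs as [Hs|Hs]; apply existsb_exists in Hs as (l & Hl & Hlt); exists l;
      (split; [exact Hl|]); apply andb_true_iff in Hlt as [Hq Hb];
      apply Nat.eqb_eq in Hq; apply eqb_prop in Hb;
      destruct (Hdiv _ (Hvar C HC l Hl)) as (Hh0 & Hm & Hc).
    + rewrite (Nat.div_small u) in Hq by assumption.
      destruct (Nat.ltb_spec (fst l) h); [exact Hb|lia].
    + rewrite Hv1 in Hq.
      destruct (Nat.ltb_spec (fst l) h); [lia|exact Hb].
Qed.

(** * Number of distinct clauses of bounded length *)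

Fixpoint short_lists {A : Type} (k : nat) (l : list A) : list (list A) :=
  match k with
  | 0 => [[]]
  | S k => [] :: flat_map (fun t => map (fun a => a :: t) l) (short_lists k l)
  end.

Lemma in_short_lists {A : Type} (l : list A) k : forall t,
  length t <= k -> (forall a, In a t -> In a l) -> In t (short_lists k l).
Proof.
  induction k as [|k IH]; intros [|a t] Hk Ht; cbn in *; try lia; auto.
  right. apply in_flat_map. exists t. split.
  - apply IH; [lia|auto].
  - apply in_map_iff. exists a. auto.
Qed.

Lemma length_short_lists {A : Type} (l : list A) k :
  length (short_lists k l) <= (length l + 1) ^ k.
Proof.
  induction k as [|k IH]; [reflexivity|]. cbn [short_lists length].
  pose proof (length_flat_map_le (fun t => map (fun a => a :: t) l) (length l) (short_lists k l))
    as H.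
  rewrite Nat.pow_succ_r'.
  assert (1 <= (length l + 1) ^ k) by (apply Nat.neq_0_lt_0, Nat.pow_nonzero; lia).
  specialize (H ltac:(intros; cbn beta; rewrite length_map; lia)). nia.
Qed.

(** Distinct clauses are distinct lists of length at most [k] over the [2 * nvars F] literals. *)
Lemma kcnf_num_clauses k F :
  is_kcnf k F -> length (clauses F) <= (2 * nvars F + 1) ^ k.
Proof.
  intros [Hd Hc].
  set (lits := list_prod (seq 0 (nvars F)) [true; false]).
  assert (Hl : length lits = 2 * nvars F)
    by (unfold lits; rewrite length_prod, length_seq; cbn; lia).
  rewrite <- Hl. eapply Nat.le_trans; [|apply length_short_lists].
  apply NoDup_incl_length; [exact Hd|]. intros C HC.
  destruct (Hc C HC) as [Hk Hv]. apply in_short_lists; [exact Hk|].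
  intros [x b] Hx. specialize (Hv _ Hx). apply in_prod_iff. cbn [fst] in Hv.
  rewrite in_seq. split; [lia|]. destruct b; cbn; auto.
Qed.

(** * The reduction as a program *)

Lemma firstn_succ_nth {A : Type} q (l : list A) d :
  q < length l -> firstn (S q) l = firstn q l ++ [nth q l d].
Proof.
  revert q. induction l as [|a l IH]; intros [|q] Hq; cbn in *; try lia; auto.
  rewrite <- IH by lia. reflexivity.
Qed.

Definition inc (x : nat) : cmd := Assign x (Bin Add (Var x) (Num 1)).

Definition emit (e : expr) : cmd := Seq (Put 2 (Var 9) e) (inc 9).

Definition emit_arc (weighted : bool) (a b : expr) : cmd :=
  Seq (emit a) (Seq (emit b) (if weighted then emit (Num 1) else Skip)).

Definition emit_edge (directed weighted : bool) (a b : expr) : cmd :=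
  Seq (emit_arc weighted a b) (if directed then emit_arc weighted b a else Skip).

(* Variables: 0 number of variables, 1 number of clauses M, 2 half size h,
   3 N = 2 ^ h, 4 partial assignment, 5 clause index, 6 literals left in the
   clause, 7 input position, 8 flag, 9 output position. Arrays: 0 and 1 are the
   input and output of the formula, 2 and 3 those of the subroutine. *)
Definition lit_test : expr :=
  let v := Bin Div (Get 0 (Var 7)) (Num 2) in
  Bin Mul
    (Bin Eqb (Bin Div v (Var 2)) (Bin Div (Var 4) (Var 3)))
    (Bin Eqb (Bin Mod (Bin Shr (Var 4) (Bin Mod v (Var 2))) (Num 2))
             (Bin Mod (Get 0 (Var 7)) (Num 2))).

Definition scan_literal : cmd :=
  Seq (Cond lit_test (Assign 8 (Num 1)) Skip)
      (Seq (inc 7) (Assign 6 (Bin Sub (Var 6) (Num 1)))).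

Definition clause_vertex : expr := Bin Add (Bin Add (Var 3) (Var 3)) (Var 5).
Definition hub_vertex : expr := Bin Add (Bin Add (Var 3) (Var 3)) (Var 1).

Section Program.

Variables directed weighted : bool.

(** Either branch leaves the flag at 0, ready for the next clause. *)
Definition scan_clause : cmd :=
  Seq (Assign 6 (Get 0 (Var 7))) (Seq (inc 7) (Seq (Loop (Var 6) scan_literal)
  (Seq (Cond (Var 8) (Assign 8 (Num 0))
                     (emit_edge directed weighted (Var 4) clause_vertex))
       (inc 5)))).

(** The clauses start at input position 2, after the two header words. Variables 5 and 7 return to
    0, so that only the assignment and the output change from one pass to the next. *)
Definition scan_assignment : cmd :=
  Seq (Assign 7 (Num 2)) (Seq (Loop (Bin Ltb (Var 5) (Var 1)) scan_clause)
  (Seq (emit_edge directed weighted (Var 4)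
          (Bin Add hub_vertex (Bin Div (Var 4) (Var 3))))
  (Seq (Assign 5 (Num 0)) (Seq (Assign 7 (Num 0)) (inc 4))))).

Definition link_clause : cmd :=
  Seq (emit_edge directed weighted clause_vertex hub_vertex)
  (Seq (emit_edge directed weighted clause_vertex (Bin Add hub_vertex (Num 1)))
       (inc 5)).

Definition setup : cmd :=
  Seq (Assign 0 (Get 0 (Num 0))) (Seq (Assign 1 (Get 0 (Num 1)))
  (Seq (Assign 2 (Bin Div (Bin Add (Var 0) (Num 1)) (Num 2)))
  (Seq (Assign 3 (Bin Shl (Num 1) (Var 2))) (Assign 9 (Num 2))))).

(** Output positions 0 and 1 are skipped at first and filled last, when the number of edges can be
    read off from the length of the output. *)
Definition build : cmd :=
  Seq setup
  (Seq (Loop (Bin Ltb (Var 4) (Bin Add (Var 3) (Var 3))) scan_assignment)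
  (Seq (Loop (Bin Ltb (Var 5) (Var 1)) link_clause)
  (Seq (emit_edge directed weighted hub_vertex (Bin Add hub_vertex (Num 1)))
  (Seq (Put 2 (Num 0) (Bin Add hub_vertex (Num 2)))
       (Put 2 (Num 1) (Bin Div (Bin Sub (Var 9) (Num 2)) (Num (if weighted then 3 else 2)))))))).

(** The encoding of eccentricity 3 is 4, and array 3 is the renamed output array of the
    subroutine. *)
Definition decide : cmd :=
  Seq (Assign 4 (Num 0)) (Seq (Assign 8 (Num 0))
  (Seq (Loop (Bin Ltb (Var 4) (Var 3))
          (Seq (Cond (Bin Eqb (Get 3 (Var 4)) (Num 4)) (Assign 8 (Num 1)) Skip) (inc 4)))
       (Put 1 (Num 0) (Var 8)))).

Definition encode_arc (e : nat * nat * nat) : list nat :=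
  let '(u, v, c) := e in if weighted then [u; v; c] else [u; v].

Definition pair_words (e : nat * nat) : list nat :=
  flat_map encode_arc (orient directed e).

Lemma length_pair_words e : length (pair_words e) <= 6.
Proof. unfold pair_words, orient, encode_arc. destruct e, directed, weighted; cbn; lia. Qed.

(** Cells past the end of a list hold 0, as in an initial state. *)
Definition layout (input L : list nat) (a i : nat) : nat :=
  match a with 0 => nth i input 0 | 2 => nth i L 0 | _ => 0 end.

Lemma computes_assign_to w z x e m l :
  x < nvar -> length (vars m) = nvar -> exact w e m -> set_nth x (den e m) (vars m) = l ->
  computes w z (Assign x e) m (cost e + 1) (Store l (arrays m)).
Proof. intros ? ? ? <-. now apply computes_assign. Qed.

Lemma layout_append input L v a i :
  upd (layout input L) 2 (upd (layout input L 2) (length L) v) a i = layout input (L ++ [v]) a i.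
Proof.
  unfold upd. destruct a as [|[|[|a]]]; try reflexivity. cbn.
  destruct (Nat.eqb_spec i (length L)) as [->|Hn].
  - now rewrite nth_middle.
  - destruct (Nat.lt_ge_cases i (length L)) as [H|H]; [now rewrite app_nth1|].
    rewrite !nth_overflow; rewrite ?length_app; cbn; lia || auto.
Qed.

Definition encode_clause (C : clause) : list nat := length C :: map encode_literal C.

(** * Correctness and running time of the construction *)

Section Correctness.

Variables (w : nat) (z : nat -> nat) (k n h : nat) (Cs : list clause).
Let N := 2 ^ h.
Let M := length Cs.
Let offset (j : nat) :=
  2 + length (flat_map encode_clause (firstn j Cs)).
Let input := n :: M :: flat_map encode_clause Cs.

Hypothesis h_eq : h = (n + 1) / 2.
(** The expression in parentheses bounds the number of pairs, and a pair takes at most 6 words; so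
    all positions and vertex numbers fit in a word. *)
Hypothesis wide : 12 * (N * (2 * (M + 1)) + M * 2 + 1) + length input + n + 20 < 2 ^ w.
Hypothesis Cs_length : forall C, In C Cs -> length C <= k.

(** Variables 0 to 3 stay fixed after the setup, and variable 9 is tied to the length of the
    output. *)
Let St (s j i ptr sat : nat) (L : list nat) : store :=
  Store [n; M; h; N; s; j; i; ptr; sat; length L] (layout input L).

Let w_pos : 0 < w.
Proof. destruct w; [cbn in wide; lia|lia]. Qed.

Ltac side := cbn [exact op_exact den den_op vars arrays nth set_nth St nvar]; unfold nvar;
  repeat split; try lia.

Ltac same_vars := repeat (apply (f_equal2 (@cons nat)); [try reflexivity; try lia|]); reflexivity.

Lemma computes_emit e v s j i ptr sat L :
  exact w e (St s j i ptr sat L) -> den e (St s j i ptr sat L) = v ->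
  length L + 1 < 2 ^ w ->
  computes w z (emit e) (St s j i ptr sat L) (cost e + 6) (St s j i ptr sat (L ++ [v])).
Proof.
  intros He <- Hl. unfold emit.
  eapply computes_weaken.
  - eapply computes_seq.
    + apply computes_put; [side|exact He].
    + eapply computes_assign_to; [side|reflexivity|side|]; reflexivity.
  - cbn. lia.
  - cbn. now rewrite length_app.
  - intros a b. apply layout_append.
Qed.

(** The value may not depend on the output [L], since an operand is evaluated after others have been
    emitted; the cost bound gives all edges the same time bound. *)
Definition stable (e : expr) (v s j i ptr sat : nat) : Prop :=
  cost e <= 10 /\
  forall L, exact w e (St s j i ptr sat L) /\ den e (St s j i ptr sat L) = v.

Lemma computes_emit_arc a b u v s j i ptr sat L :
  stable a u s j i ptr sat -> stable b v s j i ptr sat ->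
  length L + 3 < 2 ^ w ->
  computes w z (emit_arc weighted a b) (St s j i ptr sat L) 40
    (St s j i ptr sat (L ++ encode_arc (u, v, 1))).
Proof.
  intros [Ka Ha] [Kb Hb] Hl. unfold emit_arc, encode_arc.
  eapply computes_weaken.
  - eapply computes_seq; [apply computes_emit; [apply Ha|apply Ha|lia]|].
    eapply computes_seq; [apply computes_emit; [apply Hb|apply Hb|rewrite length_app; cbn; lia]|].
    instantiate (1 := if weighted then St s j i ptr sat (((L ++ [u]) ++ [v]) ++ [1])
                      else St s j i ptr sat ((L ++ [u]) ++ [v])).
    (* The third word takes 1 + 6 steps and each endpoint at most 10 + 6, in all at most 39. *)
    instantiate (1 := 7). destruct weighted.
    + apply (computes_emit (Num 1)); [side|reflexivity|rewrite !length_app; cbn; lia].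
    + eapply computes_weaken; [apply computes_skip|lia|auto|auto].
  - lia.
  - destruct weighted; now rewrite <- !app_assoc.
  - destruct weighted; now rewrite <- !app_assoc.
Qed.

Lemma computes_emit_edge a b u v s j i ptr sat L :
  stable a u s j i ptr sat -> stable b v s j i ptr sat ->
  length L + 6 < 2 ^ w ->
  computes w z (emit_edge directed weighted a b) (St s j i ptr sat L) 80
    (St s j i ptr sat (L ++ pair_words (u, v))).
Proof.
  intros Ha Hb Hl. unfold emit_edge, pair_words, orient. cbn [flat_map fst snd].
  eapply computes_weaken.
  - eapply computes_seq; [apply computes_emit_arc; eauto; lia|].
    instantiate (1 := if directed
        then St s j i ptr sat ((L ++ encode_arc (u, v, 1)) ++ encode_arc (v, u, 1))
        else St s j i ptr sat (L ++ encode_arc (u, v, 1))).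
    instantiate (1 := 40). destruct directed.
    + apply computes_emit_arc; auto. rewrite length_app. unfold encode_arc.
      destruct weighted; cbn; lia.
    + eapply computes_weaken; [apply computes_skip|lia|auto|auto].
  - lia.
  - destruct directed; cbn [flat_map]; now rewrite ?app_nil_r, <- ?app_assoc.
  - destruct directed; cbn [flat_map]; now rewrite ?app_nil_r, <- ?app_assoc.
Qed.

(** The code [2 * v + b] of a literal is taken apart by division by 2, a shifted number modulo 2 is
    the tested bit, and the product of two truth values is their conjunction. *)
Lemma den_lit_test s j i ptr sat L l :
  nth ptr input 0 = encode_literal l ->
  den lit_test (St s j i ptr sat L) = Nat.b2n (lit_true h s l).
Proof.
  intros E. cbn [lit_test den den_op vars arrays nth St layout]. rewrite E.
  destruct l as [v b]. unfold encode_literal, lit_true. cbn [fst snd].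
  assert (E1 : (2 * v + Nat.b2n b) / 2 = v).
  { symmetry. apply Nat.div_unique with (Nat.b2n b); [destruct b; cbn; lia|lia]. }
  assert (E2 : (2 * v + Nat.b2n b) mod 2 = Nat.b2n b).
  { symmetry. apply Nat.mod_unique with v; [destruct b; cbn; lia|lia]. }
  rewrite E1, E2. fold N.
  rewrite Nat.shiftr_div_pow2, <- Nat.testbit_spec'.
  destruct (v / h =? s / N), (Nat.testbit s (v mod h)), b; reflexivity.
Qed.

Lemma input_split j :
  j < M ->
  exists pre post, length pre = offset j /\
    input = pre ++ encode_clause (nth j Cs []) ++ post /\
    offset (S j) = offset j + 1 + length (nth j Cs []).
Proof.
  intros Hj.
  exists (n :: M :: flat_map encode_clause (firstn j Cs)), (flat_map encode_clause (skipn (S j) Cs)).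
  assert (E : Cs = firstn j Cs ++ nth j Cs [] :: skipn (S j) Cs)
    by (symmetry; apply (firstn_skipn_middle); apply nth_error_nth'; exact Hj).
  split; [reflexivity|]. split.
  - unfold input. rewrite E at 1. rewrite flat_map_app. reflexivity.
  - unfold offset.
    rewrite (firstn_succ_nth j Cs [] Hj), flat_map_app, length_app. cbn. rewrite app_nil_r, length_map. lia.
Qed.

Lemma input_length_word j : j < M -> nth (offset j) input 0 = length (nth j Cs []).
Proof.
  intros Hj. destruct (input_split j Hj) as (pre & post & <- & -> & _).
  rewrite app_nth2, Nat.sub_diag by lia. reflexivity.
Qed.

Lemma input_literal_word j q l :
  j < M -> q < length (nth j Cs []) ->
  nth (offset j + 1 + q) input 0 = encode_literal (nth q (nth j Cs []) l).
Proof.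
  intros Hj Hq. destruct (input_split j Hj) as (pre & post & <- & -> & _).
  rewrite app_nth2 by lia. replace (length pre + 1 + q - length pre) with (S q) by lia.
  rewrite app_nth1 by (unfold encode_clause; cbn [length]; rewrite length_map; lia).
  unfold encode_clause. cbn [nth].
  rewrite nth_indep with (d' := encode_literal l) by (rewrite length_map; lia).
  apply map_nth.
Qed.

Lemma offset_le j : j < M -> offset (S j) <= length input.
Proof.
  intros Hj. destruct (input_split j Hj) as (pre & post & <- & -> & ->).
  rewrite !length_app. cbn. rewrite length_map. lia.
Qed.

Lemma computes_scan_literals s j L :
  j < M ->
  computes w z (Loop (Var 6) scan_literal)
    (St s j (length (nth j Cs [])) (offset j + 1) 0 L) (40 * k + 2)
    (St s j 0 (offset (S j)) (Nat.b2n (existsb (lit_true h s) (nth j Cs []))) L).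
Proof.
  intros Hj. set (C := nth j Cs []).
  assert (HC : length C <= k) by (apply Cs_length, nth_In; exact Hj).
  pose proof (offset_le j Hj) as Hoff.
  destruct (input_split j Hj) as (_ & _ & _ & _ & EO). fold C in EO.
  set (m := fun q => St s j (length C - q) (offset j + 1 + q)
                       (Nat.b2n (existsb (lit_true h s) (firstn q C))) L).
  replace (St s j (length C) (offset j + 1) 0 L) with (m 0)
    by (unfold m, St; cbn [firstn existsb Nat.b2n]; now rewrite Nat.sub_0_r, Nat.add_0_r).
  replace (St s j 0 (offset (S j)) (Nat.b2n (existsb (lit_true h s) C)) L) with (m (length C))
    by (unfold m; now rewrite firstn_all, Nat.sub_diag, EO).
  eapply computes_weaken.
  (* The 37 steps are 29 for the conditional on [lit_test], whose cost is 26, and 4 for each of the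
     two updates. *)
  - apply computes_loop with (t := 37) (k := length C) (m := m).
    + intros q _. side.
    + intros q Hq. unfold m, St. cbn [den vars nth]. lia.
    + unfold m, St. cbn [den vars nth]. lia.
    + intros q Hq.
      set (l := nth q C (0, false)).
      assert (Ef : firstn (S q) C = firstn q C ++ [l]) by now apply firstn_succ_nth.
      assert (Ed : den lit_test (m q) = Nat.b2n (lit_true h s l))
        by (apply den_lit_test, input_literal_word; auto).
      eapply computes_weaken.
      * eapply computes_seq with
          (m1 := St s j (length C - q) (offset j + 1 + q)
                    (Nat.b2n (existsb (lit_true h s) (firstn (S q) C))) L).
        { apply computes_cond with (t := 2).
          - unfold lit_test, m. side.
            match goal with |- Nat.b2n ?a * Nat.b2n ?b < _ => destruct a, b end; cbn; lia.
          - intros H. eapply computes_assign_to; [side|reflexivity|side|].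
            rewrite Ed in H. cbn [den vars m St set_nth].
            rewrite Ef, existsb_app. cbn [existsb]. destruct (lit_true h s l); [|now elim H].
            now rewrite orb_true_r.
          - intros H. eapply computes_weaken; [apply computes_skip|lia| |reflexivity].
            rewrite Ed in H. cbn [vars m St].
            rewrite Ef, existsb_app. cbn [existsb]. destruct (lit_true h s l); [easy|].
            now rewrite !orb_false_r. }
        eapply computes_seq.
        { eapply computes_assign_to; [side|reflexivity|side|reflexivity]. }
        eapply computes_assign_to; [side|reflexivity|side|reflexivity].
      * cbn. lia.
      * cbn [vars m St set_nth den den_op nth]. same_vars.
      * reflexivity.
  - cbn [cost]. nia.
  - reflexivity.
  - reflexivity.
Qed.

Lemma computes_scan_clause s j L :
  s < 2 * N -> j < M -> length L + 6 < 2 ^ w ->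
  computes w z scan_clause (St s j 0 (offset j) 0 L) (40 * k + 100)
    (St s (S j) 0 (offset (S j)) 0
       (L ++ flat_map pair_words (conflict_pairs h s Cs j))).
Proof.
  intros Hs Hj Hl. pose proof (offset_le j Hj) as Hoff.
  destruct (input_split j Hj) as (_ & _ & _ & _ & EO).
  eapply computes_weaken.
  - eapply computes_seq with (m1 := St s j (length (nth j Cs [])) (offset j) 0 L).
    { eapply computes_assign_to; [side|reflexivity|side|].
      cbn [den vars arrays St set_nth nth layout]. now rewrite input_length_word. }
    eapply computes_seq with (m1 := St s j (length (nth j Cs [])) (offset j + 1) 0 L).
    { eapply computes_assign_to; [side|reflexivity|side|reflexivity]. }
    eapply computes_seq; [now apply computes_scan_literals|].
    eapply computes_seq with
      (m1 := St s j 0 (offset (S j)) 0 (L ++ flat_map pair_words (conflict_pairs h s Cs j))).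
    { apply computes_cond with (t := 80); [side| |];
        cbn [den vars St nth]; unfold conflict_pairs, falsifies;
        destruct (existsb (lit_true h s) (nth j Cs [])); cbn [Nat.b2n negb]; intros H;
        try easy; cbn [flat_map].
      - eapply computes_weaken; [eapply computes_assign_to; [side|reflexivity|side|reflexivity]
          |cbn; lia| |]; cbn [vars arrays St set_nth den]; now rewrite app_nil_r.
      - rewrite app_nil_r. apply computes_emit_edge; [| |exact Hl].
        + split; [cbn; lia|]. intros L'. side.
        + unfold clause_vertex. split; [cbn; lia|]. fold N. intros L'. side. }
    eapply computes_assign_to; [side|reflexivity|side|reflexivity].
  - cbn. lia.
  - cbn [vars St set_nth den den_op nth]. same_vars.
  - reflexivity.
Qed.

Lemma length_words_le {A : Type} (f : A -> list (nat * nat)) c l :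
  (forall x, length (f x) <= c) ->
  length (flat_map pair_words (flat_map f l)) <= 6 * (length l * c).
Proof.
  intros Hf. pose proof (length_flat_map_le f c l (fun x _ => Hf x)).
  pose proof (length_flat_map_le pair_words 6 (flat_map f l)
                (fun e _ => length_pair_words e)). lia.
Qed.

Lemma computes_scan_assignment s L :
  s < 2 * N -> length L + 6 * (M + 1) < 2 ^ w ->
  computes w z scan_assignment (St s 0 0 0 0 L) (M * (40 * k + 110) + 120)
    (St (S s) 0 0 0 0 (L ++ flat_map pair_words (assignment_pairs h Cs s))).
Proof.
  intros Hs Hl. pose proof (pow2_pos h) as HN. fold N in HN.
  set (m := fun j => St s j 0 (offset j) 0
              (L ++ flat_map pair_words (flat_map (conflict_pairs h s Cs) (seq 0 j)))).
  assert (Hlen : forall j, length (L ++ flat_map pair_words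
                   (flat_map (conflict_pairs h s Cs) (seq 0 j))) <= length L + 6 * j).
  { intros j. rewrite length_app.
    pose proof (length_words_le (conflict_pairs h s Cs) 1 (seq 0 j) (length_conflict_pairs h Cs s)) as H.
    rewrite length_seq in H. lia. }
  assert (Hhub : s / N <= 1) by (destruct (half_cases N s Hs) as [[-> _]|[-> _]]; lia).
  eapply computes_weaken.
  - eapply computes_seq with (m1 := m 0).
    { unfold m. cbn [seq flat_map]. rewrite app_nil_r.
      eapply computes_assign_to; [side|reflexivity|side|reflexivity]. }
    eapply computes_seq.
    { apply computes_loop with (k := M) (m := m) (t := 40 * k + 100).
      - intros j Hj. unfold m. side.
      - intros j Hj. unfold m. cbn [den den_op vars nth St].
        destruct (Nat.ltb_spec j M); [discriminate|lia].
      - unfold m. cbn [den den_op vars nth St]. now rewrite Nat.ltb_irrefl.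
      - intros j Hj. unfold m.
        rewrite seq_S, flat_map_app, flat_map_app, app_assoc. cbn [flat_map Nat.add].
        rewrite app_nil_r. apply computes_scan_clause; auto.
        specialize (Hlen j). lia. }
    eapply computes_seq.
    { unfold m. apply computes_emit_edge with (u := s) (v := 2 * N + M + s / N).
      - split; [cbn; lia|]. intros L'. side.
      - unfold hub_vertex. split; [cbn; lia|]. intros L'. side.
      - specialize (Hlen M). lia. }
    eapply computes_seq.
    { eapply computes_assign_to; [side|reflexivity|side|reflexivity]. }
    eapply computes_seq.
    { eapply computes_assign_to; [side|reflexivity|side|reflexivity]. }
    eapply computes_assign_to; [side|reflexivity|side|reflexivity].
  - cbn [cost]. lia.
  - unfold assignment_pairs. rewrite flat_map_app. cbn [flat_map]. fold N M.
    cbn [vars St set_nth den den_op nth]. rewrite app_nil_r, app_assoc. same_vars.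
  - unfold assignment_pairs. rewrite flat_map_app. cbn [flat_map]. fold N M.
    cbn [arrays St]. now rewrite app_nil_r, app_assoc.
Qed.

Lemma computes_link_clause j L :
  j < M -> length L + 12 < 2 ^ w ->
  computes w z link_clause (St (2 * N) j 0 0 0 L) 170
    (St (2 * N) (S j) 0 0 0 (L ++ flat_map pair_words (clause_pairs h M j))).
Proof.
  intros Hj Hl. unfold clause_pairs. fold N. cbn [flat_map].
  eapply computes_weaken.
  - eapply computes_seq.
    { apply computes_emit_edge with (u := 2 * N + j) (v := 2 * N + M); [| |lia];
        unfold hub_vertex, clause_vertex; (split; [cbn; lia|]); intros L'; side. }
    eapply computes_seq.
    { apply computes_emit_edge with (u := 2 * N + j) (v := 2 * N + M + 1).
      1, 2: unfold hub_vertex, clause_vertex; (split; [cbn; lia|]); intros L'; side.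
      rewrite length_app. pose proof (length_pair_words (2 * N + j, 2 * N + M)). lia. }
    eapply computes_assign_to; [side|reflexivity|side|reflexivity].
  - cbn [cost]. lia.
  - cbn [vars St set_nth den den_op nth]. rewrite app_nil_r, app_assoc. same_vars.
  - cbn [arrays St]. now rewrite app_nil_r, app_assoc.
Qed.

Lemma computes_setup :
  computes w z setup (Store (repeat 0 nvar) (layout input [])) 25 (St 0 0 0 0 0 [0; 0]).
Proof.
  pose proof (pow2_pos h) as HN. fold N in HN.
  eapply computes_weaken.
  - eapply computes_seq with (m1 := Store [n; 0; 0; 0; 0; 0; 0; 0; 0; 0] (layout input [])).
    { eapply computes_assign_to; [side|reflexivity|side|reflexivity]. }
    eapply computes_seq with (m1 := Store [n; M; 0; 0; 0; 0; 0; 0; 0; 0] (layout input [])).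
    { eapply computes_assign_to; [side|reflexivity|side|reflexivity]. }
    eapply computes_seq with (m1 := Store [n; M; h; 0; 0; 0; 0; 0; 0; 0] (layout input [])).
    { eapply computes_assign_to; [side|reflexivity|side|].
      cbn [den den_op vars nth set_nth]. now rewrite <- h_eq. }
    eapply computes_seq with (m1 := Store [n; M; h; N; 0; 0; 0; 0; 0; 0] (layout input [])).
    { eapply computes_assign_to; [side|reflexivity|side|];
      cbn [den den_op vars nth set_nth]; rewrite Nat.shiftl_1_l; fold N; [lia|reflexivity]. }
    eapply computes_assign_to; [side|reflexivity|side|reflexivity].
  - cbn. lia.
  - reflexivity.
  (* The two words reserved for the header are not written: their cells already hold 0. *)
  - intros [|[|[|a]]] i; try reflexivity. cbn. destruct i as [|[|[|i]]]; reflexivity.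
Qed.

Lemma encode_sat_graph :
  encode_graph weighted (sat_graph directed h Cs) =
  2 * N + M + 2 :: nedges (sat_graph directed h Cs) :: flat_map pair_words (pairs h Cs).
Proof.
  unfold encode_graph, sat_graph. cbn [nverts edges]. fold N M. do 2 f_equal.
  apply flat_map_flat_map.
Qed.

(** Every arc takes the same number of words, which makes the final division in [build] exact. *)
Lemma length_pairs_words :
  length (flat_map pair_words (pairs h Cs)) =
    nedges (sat_graph directed h Cs) * (if weighted then 3 else 2) /\
  length (flat_map pair_words (pairs h Cs)) <= 6 * (N * (2 * (M + 1)) + M * 2 + 1).
Proof.
  split.
  - unfold nedges, sat_graph. cbn [edges].
    replace (flat_map pair_words (pairs h Cs))
      with (flat_map encode_arc (flat_map (orient directed) (pairs h Cs)))
      by apply flat_map_flat_map.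
    induction (flat_map (orient directed) (pairs h Cs)) as [|[[u v] c] l IH]; [reflexivity|].
    cbn [flat_map length]. rewrite length_app, IH. unfold encode_arc.
    destruct weighted; cbn; lia.
  - pose proof (length_flat_map_le pair_words 6 (pairs h Cs) (fun e _ => length_pair_words e)).
    pose proof (length_pairs h Cs) as Hp. fold N M in Hp. lia.
Qed.

Lemma computes_build :
  computes w z build (Store (repeat 0 nvar) (layout input [])) (1000 * (k + 1) * (M + 1) * N)
    (Store [n; M; h; N; 2 * N; M; 0; 0; 0; 2 + length (flat_map pair_words (pairs h Cs))]
       (layout input (encode_graph weighted (sat_graph directed h Cs)))).
Proof.
  pose proof (pow2_pos h) as HN. fold N in HN.
  set (m1 := fun s => St s 0 0 0 0
              ([0; 0] ++ flat_map pair_words (flat_map (assignment_pairs h Cs) (seq 0 s)))).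
  set (L1 := [0; 0] ++ flat_map pair_words (flat_map (assignment_pairs h Cs) (seq 0 (2 * N)))).
  set (m2 := fun j => St (2 * N) j 0 0 0
              (L1 ++ flat_map pair_words (flat_map (clause_pairs h M) (seq 0 j)))).
  assert (Hlen1 : forall s, length ([0; 0] ++ flat_map pair_words
                   (flat_map (assignment_pairs h Cs) (seq 0 s))) <= 2 + 6 * (s * (M + 1))).
  { intros s. rewrite length_app.
    pose proof (length_words_le (assignment_pairs h Cs) (M + 1) (seq 0 s)
                  (length_assignment_pairs h Cs)) as H.
    rewrite length_seq in H. cbn [length]. lia. }
  assert (Hlen2 : forall j, length (L1 ++ flat_map pair_words
                   (flat_map (clause_pairs h M) (seq 0 j)))
                   <= 2 + 6 * (2 * N * (M + 1)) + 6 * (j * 2)).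
  { intros j. rewrite length_app. specialize (Hlen1 (2 * N)). fold L1 in Hlen1.
    pose proof (length_words_le (clause_pairs h M) 2 (seq 0 j) (fun _ => le_n _)) as H.
    rewrite length_seq in H. lia. }
  assert (EL : (L1 ++ flat_map pair_words (flat_map (clause_pairs h M) (seq 0 M))) ++
                 pair_words (2 * N + M, 2 * N + M + 1) =
               0 :: 0 :: flat_map pair_words (pairs h Cs)).
  { unfold L1, pairs. fold N M. rewrite !flat_map_app. cbn [app flat_map].
    now rewrite app_nil_r, <- app_assoc. }
  destruct length_pairs_words as [HW HW'].
  eapply computes_weaken.
  - eapply computes_seq; [apply computes_setup|].
    eapply computes_seq with (m1 := m2 0).
    { replace (m2 0) with (m1 (2 * N))
        by (unfold m1, m2; fold L1; cbn [seq flat_map]; now rewrite app_nil_r).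
      apply computes_loop with (k := 2 * N) (m := m1) (t := M * (40 * k + 110) + 120).
      - intros s Hs. unfold m1. side.
      - intros s Hs. unfold m1. cbn [den den_op vars nth St].
        destruct (Nat.ltb_spec s (N + N)); [discriminate|lia].
      - unfold m1. cbn [den den_op vars nth St].
        destruct (Nat.ltb_spec (2 * N) (N + N)); [lia|reflexivity].
      - intros s Hs. unfold m1.
        rewrite seq_S, flat_map_app, flat_map_app, app_assoc. cbn [flat_map Nat.add].
        rewrite (app_nil_r (assignment_pairs h Cs s)). apply computes_scan_assignment; auto.
        specialize (Hlen1 s). nia. }
    eapply computes_seq.
    { apply computes_loop with (k := M) (m := m2) (t := 170).
      - intros j Hj. unfold m2. side.
      - intros j Hj. unfold m2. cbn [den den_op vars nth St].
        destruct (Nat.ltb_spec j M); [discriminate|lia].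
      - unfold m2. cbn [den den_op vars nth St]. now rewrite Nat.ltb_irrefl.
      - intros j Hj. unfold m2.
        rewrite seq_S, flat_map_app, flat_map_app, app_assoc. cbn [Nat.add].
        replace (flat_map (clause_pairs h M) [j]) with (clause_pairs h M j)
          by (cbn [flat_map]; now rewrite app_nil_r).
        apply computes_link_clause; auto. specialize (Hlen2 j). nia. }
    eapply computes_seq.
    { unfold m2. apply computes_emit_edge with (u := 2 * N + M) (v := 2 * N + M + 1).
      1, 2: unfold hub_vertex; (split; [cbn; lia|]); intros L'; side.
      specialize (Hlen2 M). nia. }
    rewrite EL.
    eapply computes_seq; [apply computes_put; unfold hub_vertex; side|].
    apply computes_put; [side|]. destruct weighted; side; cbn [length]; lia.
  - cbn [cost hub_vertex]. destruct weighted; nia.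
  - reflexivity.
  - rewrite encode_sat_graph. intros a i. unfold hub_vertex, upd, layout.
    cbn [arrays vars St den den_op nth length]. rewrite HW.
    destruct a as [|[|[|a]]]; try reflexivity.
    destruct i as [|[|i]]; cbn [Nat.eqb nth]; try reflexivity; try lia.
    replace (S (S (nedges (sat_graph directed h Cs) * (if weighted then 3 else 2))) - 2)
      with (nedges (sat_graph directed h Cs) * (if weighted then 3 else 2)) by lia.
    destruct weighted; now apply Nat.div_mul.
Qed.

End Correctness.

(** The arrays [A] are arbitrary because the subroutine leaves unknown contents behind; variables 4
    and 8 are reset first. *)
Lemma computes_decide w z A a0 a1 a2 N a4 a5 a6 a7 a8 a9 :
  N + 5 < 2 ^ w ->
  computes w z decide (Store [a0; a1; a2; N; a4; a5; a6; a7; a8; a9] A) (30 * N + 20)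
    (Store [a0; a1; a2; N; N; a5; a6; a7; Nat.b2n (existsb (fun u => A 3 u =? 4) (seq 0 N)); a9]
       (upd A 1 (upd (A 1) 0 (Nat.b2n (existsb (fun u => A 3 u =? 4) (seq 0 N)))))).
Proof.
  intros Hw. assert (w_pos : 0 < w) by (destruct w; [cbn in Hw; lia|lia]).
  set (m := fun s => Store [a0; a1; a2; N; s; a5; a6; a7;
                            Nat.b2n (existsb (fun u => A 3 u =? 4) (seq 0 s)); a9] A).
  eapply computes_weaken.
  - eapply computes_seq with (m1 := Store [a0; a1; a2; N; 0; a5; a6; a7; a8; a9] A).
    { eapply computes_assign_to; [unfold nvar; lia|reflexivity|cbn [exact]; lia|reflexivity]. }
    eapply computes_seq with (m1 := m 0).
    { eapply computes_assign_to; [unfold nvar; lia|reflexivity|cbn [exact]; lia|reflexivity]. }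
    eapply computes_seq.
    { apply computes_loop with (k := N) (m := m) (t := 17).
      - intros s Hs. cbn [exact op_exact]. unfold nvar. lia.
      - intros s Hs. unfold m. cbn [den den_op vars nth].
        destruct (Nat.ltb_spec s N); [discriminate|lia].
      - unfold m. cbn [den den_op vars nth]. now rewrite Nat.ltb_irrefl.
      - intros s Hs.
        eapply computes_weaken.
        + eapply computes_seq with
            (m1 := Store [a0; a1; a2; N; s; a5; a6; a7;
                     Nat.b2n (existsb (fun u => A 3 u =? 4) (seq 0 (S s))); a9] A).
          { apply computes_cond with (t := 2).
            - cbn [exact op_exact]. unfold nvar. lia.
            - intros H. eapply computes_assign_to;
                [unfold nvar; lia|reflexivity|cbn [exact]; lia|].
              unfold m in *. cbn [den den_op vars nth arrays set_nth] in *.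
              rewrite seq_S, existsb_app. cbn [existsb Nat.add].
              destruct (A 3 s =? 4); [now rewrite orb_true_r|now elim H].
            - intros H. eapply computes_weaken; [apply computes_skip|lia| |reflexivity].
              unfold m in *. cbn [den den_op vars nth arrays set_nth] in *.
              rewrite seq_S, existsb_app. cbn [existsb Nat.add].
              destruct (A 3 s =? 4); [easy|now rewrite !orb_false_r]. }
          eapply computes_assign_to; [unfold nvar; lia|reflexivity| |reflexivity].
          cbn [exact op_exact den den_op vars nth]. unfold nvar. lia.
        + cbn. lia.
        + unfold m. cbn [vars set_nth den den_op nth]. now rewrite Nat.add_1_r.
        + reflexivity. }
    apply computes_put; cbn [exact]; unfold nvar; lia.
  - cbn [cost]. lia.
  - reflexivity.
  - reflexivity.
Qed.

End Program.

(** * The complete reduction, its word size and its correctness *)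

Definition reduction (directed weighted : bool) (p : cmd) : cmd :=
  Seq (build directed weighted)
      (Seq (rename (fun x => 2 * x) (fun a => a + 2) p) decide).

Definition half (n : nat) : nat := (n + 1) / 2.
(** The polynomial factor by which the numbers of vertices and edges may exceed [2 ^ half n]; 16
    comes from the edge bound [8 * (M + 1)], where [M] is at most [(2 * n + 1) ^ k]. *)
Definition blowup (k n : nat) : nat := 16 * (2 * n + 1) ^ k.

Lemma half_spec n : n <= 2 * half n <= n + 1.
Proof.
  unfold half. pose proof (Nat.div_mod_eq (n + 1) 2).
  pose proof (Nat.mod_upper_bound (n + 1) 2). lia.
Qed.

Lemma succ_double_le_pow2 n : 2 * n + 1 <= 2 ^ (n + 1).
Proof.
  induction n as [|n IH]; [cbn; lia|]. rewrite Nat.add_succ_l, Nat.pow_succ_r'.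
  assert (2 ^ 1 <= 2 ^ (n + 1)) by (apply Nat.pow_le_mono_r; lia). cbn [Nat.pow] in *. lia.
Qed.

(** The factors are at most [2 ^ n], [2 ^ ((n + 1) * k)] and [2 ^ (n + k + 107)], and the exponents
    add up to at most [(2 * k + 110) * (n + 1)]. *)
Lemma word_size_suffices k n w :
  (2 * k + 110) * (n + 1) <= w ->
  2 ^ half n * (2 * n + 1) ^ k * (n + k + 107) < 2 ^ w.
Proof.
  intros Hw. pose proof (half_spec n) as Hh.
  assert (H1 : 2 ^ half n <= 2 ^ n) by (apply Nat.pow_le_mono_r; lia).
  assert (H2 : (2 * n + 1) ^ k <= 2 ^ ((n + 1) * k)).
  { rewrite Nat.pow_mul_r. apply Nat.pow_le_mono_l, succ_double_le_pow2. }
  pose proof (Nat.pow_gt_lin_r 2 (n + k + 107) ltac:(lia)) as H3.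
  apply Nat.lt_le_trans with (2 ^ n * 2 ^ ((n + 1) * k) * 2 ^ (n + k + 107)).
  - pose proof (pow2_pos n). pose proof (pow2_pos ((n + 1) * k)).
    apply Nat.le_lt_trans with (2 ^ n * 2 ^ ((n + 1) * k) * (n + k + 107)).
    + now apply Nat.mul_le_mono_r, Nat.mul_le_mono.
    + apply Nat.mul_lt_mono_pos_l; [nia|exact H3].
  - rewrite <- !Nat.pow_add_r. apply Nat.pow_le_mono_r; nia.
Qed.

Lemma nth_lt (l : list nat) b i : 0 < b -> (forall x, In x l -> x < b) -> nth i l 0 < b.
Proof.
  intros Hb H. destruct (nth_in_or_default i l 0) as [Hi| ->]; auto.
Qed.

Lemma trunc_nth w l i : (forall x, In x l -> x < 2 ^ w) -> trunc w (nth i l 0) = nth i l 0.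
Proof. intros H. apply trunc_small, nth_lt; auto using pow2_pos. Qed.

Section Reduction.

Variables (directed weighted : bool) (p : cmd) (c : nat) (g : nat -> nat -> R).

Hypothesis p_spec : forall G : graph, is_graph directed weighted G ->
  forall w : nat, c * Nat.log2 (nverts G + max_weight G + 2) <= w ->
    runs w p (encode_graph weighted G) (g (nedges G) (nverts G))
      (fun out => forall x, x < nverts G ->
         exists e, is_ecc directed G x e /\ out x = encode_ext e).

(** The counts [m] and [v] depend on the formula and [g] is arbitrary, so they appear existentially.
    In the word size, one share serves the construction and [c] shares serve the call to [p]. *)
Lemma reduction_correct k F w :
  is_kcnf k F -> (c + 1) * (2 * k + 110) * (nvars F + 1) <= w ->
  exists m v,
    2 ^ half (nvars F) <= m <= 2 ^ half (nvars F) * blowup k (nvars F) /\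
    2 ^ half (nvars F) <= v <= 2 ^ half (nvars F) * blowup k (nvars F) /\
    runs w (reduction directed weighted p) (encode_cnf F)
      (INR (200 * (k + 1) * (2 ^ half (nvars F) * blowup k (nvars F))) + g m v)
      (fun out => (satisfiable F /\ out 0 = 1) \/ (~ satisfiable F /\ out 0 = 0)).
Proof.
  intros HF Hw. pose proof (kcnf_num_clauses k F HF) as HQ.
  set (n := nvars F) in *. set (Cs := clauses F) in *. set (h := half n).
  assert (Hw' : (2 * k + 110) * (n + 1) <= w) by nia.
  pose proof (word_size_suffices k n w Hw') as Hwide0. fold h in Hwide0.
  (* At width exactly [(2 * k + 110) * (n + 1)], the same bound controls the logarithm in the word
     size that [p] requires. *)
  pose proof (word_size_suffices k n _ (le_n _)) as Hlog. fold h in Hlog.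
  pose proof (pow2_pos h) as HN.
  assert (HQ1 : 1 <= (2 * n + 1) ^ k) by (apply Nat.neq_0_lt_0, Nat.pow_nonzero; lia).
  unfold blowup. set (N := 2 ^ h) in *. set (Q := (2 * n + 1) ^ k) in *.
  assert (HNQ : N <= N * Q /\ Q <= N * Q) by nia. clearbody Q.
  assert (Hmul : N * Q * (n + k + 107) = N * Q * n + N * Q * k + 107 * (N * Q)) by lia.
  assert (HNQn : n <= N * Q * n /\ k <= N * Q * k) by nia.
  assert (Hinput : length (encode_cnf F) <= 2 + length Cs * (k + 1)).
  { unfold encode_cnf. cbn [length].
    pose proof (length_flat_map_le encode_clause (k + 1) Cs) as H.
    change (flat_map _ (clauses F)) with (flat_map encode_clause Cs).
    assert (length (flat_map encode_clause Cs) <= length Cs * (k + 1)); [|lia].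
    apply H. intros C HC. unfold encode_clause. cbn [length]. rewrite length_map.
    pose proof (proj1 (proj2 HF C HC)). lia. }
  assert (Hwide : 12 * (N * (2 * (length Cs + 1)) + length Cs * 2 + 1)
                  + length (encode_cnf F) + n + 20 < 2 ^ w).
  { assert (N * (2 * (length Cs + 1)) <= 4 * (N * Q)) by nia.
    assert (length Cs * (k + 1) <= N * Q * k + N * Q) by nia. lia. }
  pose proof (nedges_sat_graph h Cs directed) as Hm. fold N in Hm.
  assert (Hinw : forall x, In x (encode_cnf F) -> x < 2 ^ w).
  { intros x [<-|[<-|Hx]]; fold n Cs; [lia|lia|].
    apply in_flat_map in Hx as (C & HC & [<-|Hx]).
    - pose proof (proj1 (proj2 HF C HC)). lia.
    - apply in_map_iff in Hx as (l & <- & Hl).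
      pose proof (proj2 (proj2 HF C HC) l Hl) as Hv. fold n in Hv.
      assert (2 * n <= 2 ^ w).
      { pose proof (succ_double_le_pow2 n).
        assert (2 ^ (n + 1) <= 2 ^ w) by (apply Nat.pow_le_mono_r; nia). lia. }
      unfold encode_literal. destruct (snd l); cbn [Nat.b2n]; lia. }
  set (G := sat_graph directed h Cs) in *.
  assert (Hgw : forall x, In x (encode_graph weighted G) -> x < 2 ^ w).
  { assert (N * (8 * (length Cs + 1)) < 2 ^ w) by nia.
    intros x [<-|[<-|Hx]]; [cbn [nverts G sat_graph]; fold N; nia|lia|].
    apply in_flat_map in Hx as ([[u v] d] & He & Hx).
    apply in_edges in He as (-> & He).
    assert (u < 2 * N + length Cs + 2 /\ v < 2 * N + length Cs + 2) as [Hu Hv]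
      by (destruct He as [He|[_ He]]; apply pairs_range in He; fold N in He; lia).
    assert (2 * N + length Cs + 2 < 2 ^ w) by nia.
    destruct weighted; cbn [In] in Hx; intuition (subst; lia). }
  assert (HB : N * (16 * Q) = 16 * (N * Q)) by lia.
  exists (nedges G), (nverts G).
  split; [split; [apply Hm|eapply Nat.le_trans; [apply Hm|apply Nat.mul_le_mono_l; lia]]|].
  split; [cbn [nverts G sat_graph]; fold N; lia|].
  assert (Hcw : c * Nat.log2 (nverts G + max_weight G + 2) <= w).
  { pose proof (max_weight_sat_graph h Cs directed) as H1. fold G in H1.
    assert (Hl : Nat.log2 (nverts G + max_weight G + 2) <= (2 * k + 110) * (n + 1)).
    { rewrite <- (Nat.log2_pow2 ((2 * k + 110) * (n + 1))) by lia.
      apply Nat.log2_le_mono. cbn [nverts G sat_graph] in *. fold N. lia. }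
    apply Nat.le_trans with (c * ((2 * k + 110) * (n + 1))); [now apply Nat.mul_le_mono_l|lia]. }
  destruct (p_spec G (sat_graph_is_graph h Cs directed weighted) w Hcw)
    as (t2 & s2 & E2 & T2 & Hout).
  set (z0 := fun _ : nat => 0).
  assert (R0 : represents w z0 (init w (encode_cnf F))
                 (Store (repeat 0 nvar) (layout (encode_cnf F) []))).
  { split; [apply init_bounded|]. split; [|split; [reflexivity|]].
    - intros x _. cbn [reg init vars]. symmetry. apply nth_repeat.
    - intros a i. cbn [mem init arrays]. unfold input_array.
      destruct a as [|[|[|a]]]; cbn [Nat.eqb layout]; try reflexivity.
      + now apply trunc_nth.
      + now destruct i. }
  destruct (computes_build directed weighted w z0 k n h Cs eq_refl Hwide
              (fun C HC => proj1 (proj2 HF C HC)) _ R0) as (t1 & s1 & E1 & T1 & R1).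
  fold N in R1, T1.
  (* The even registers are still 0, array 2 holds the graph and the arrays above it are 0; so with
     registers doubled and arrays shifted by 2, this is an initial state for [p]. *)
  assert (Hemb : embeds (fun x => 2 * x) (fun a => a + 2) (init w (encode_graph weighted G)) s1).
  { destruct R1 as (_ & _ & Hz & Hmem). split.
    - intros x. rewrite Hz. reflexivity.
    - intros a i. rewrite Hmem, (Nat.add_comm a 2). cbn [arrays mem init]. unfold input_array.
      destruct a as [|a]; cbn [Nat.eqb layout Nat.add]; [|reflexivity].
      symmetry. now apply trunc_nth. }
  destruct (exec_rename w (fun x => 2 * x) (fun a => a + 2) p _ t2 s2
              ltac:(cbn beta; lia) ltac:(cbn beta; lia) E2 s1 Hemb) as (s2' & E2' & [_ Hmem2] & Hodd).
  (* Whatever [p] leaves in the even registers and the arrays is adopted as the new [z] and the new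
     arrays; the variables, in odd registers, have survived. *)
  assert (R2 : represents w (fun x => reg s2' (2 * x)) s2'
                 (Store [n; length Cs; h; N; 2 * N; length Cs; 0; 0; 0;
                     2 + length (flat_map (pair_words directed weighted) (pairs h Cs))]
                    (mem s2'))).
  { split; [exact (exec_bounded _ _ _ _ _ E2' (proj1 R1))|].
    split; [|split; reflexivity].
    intros x Hx. rewrite Hodd by (unfold own; lia). now apply R1. }
  destruct (computes_decide w (fun x => reg s2' (2 * x)) (mem s2')
              n (length Cs) h N (2 * N) (length Cs) 0 0 0
              (2 + length (flat_map (pair_words directed weighted) (pairs h Cs)))
              ltac:(lia) s2' R2) as (t3 & s3 & E3 & T3 & R3).
  exists (t1 + (t2 + t3)), s3.
  split; [unfold reduction; repeat econstructor; eassumption|].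
  split.
  { rewrite !plus_INR.
    (* The call is paid for by [g]. Of the coefficient 200 * 16 = 3200, a share of 2000 covers the
       construction and 1200 the decision. *)
    enough (INR t1 + INR t3 <= INR (200 * (k + 1) * (N * (16 * Q))))%R by lra.
    rewrite <- plus_INR. apply le_INR.
    assert (H1 : (length Cs + 1) * N <= 2 * (N * Q))
      by (replace (2 * (N * Q)) with ((2 * Q) * N) by lia; apply Nat.mul_le_mono_r; lia).
    assert (H2 : 1000 * (k + 1) * (length Cs + 1) * N <= 1000 * (k + 1) * (2 * (N * Q)))
      by (rewrite <- Nat.mul_assoc; now apply Nat.mul_le_mono_l).
    replace (200 * (k + 1) * (N * (16 * Q)))
      with (1000 * (k + 1) * (2 * (N * Q)) + 1200 * (k + 1) * (N * Q)) by lia.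
    assert (H3 : 1200 * 1 * (N * Q) <= 1200 * (k + 1) * (N * Q))
      by (apply Nat.mul_le_mono_r; lia).
    lia. }
  rewrite (proj2 (proj2 (proj2 R3))). cbn [arrays]. unfold output_array, upd. cbn [Nat.eqb].
  assert (Hiff : satisfiable F <-> existsb (fun u => mem s2' 3 u =? 4) (seq 0 N) = true).
  { rewrite existsb_exists.
    rewrite (satisfiable_iff_halves F h (proj1 (half_spec n)) (fun C HC => proj2 (proj2 HF C HC))).
    fold N Cs.
    assert (Hu : forall u, u < N -> (mem s2' 3 u =? 4) = true <->
              exists v, N <= v < 2 * N /\ forall j, j < length Cs ->
                falsifies h u (nth j Cs []) = true ->
                falsifies h v (nth j Cs []) = true -> False).
    { intros u Hu. destruct (Hout u) as (e & He & Ho); [cbn [nverts G sat_graph]; fold N; lia|].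
      apply iff_trans with (2 := ecc_three h Cs directed u Hu e He).
      (* Array 3 is the image of the output array 1 of [p]. *)
      change 3 with (1 + 2). rewrite Hmem2, Nat.eqb_eq. unfold output_array in Ho. rewrite Ho.
      destruct e as [e|]; cbn [encode_ext]; split; intros H; [|injection H|discriminate H..];
        congruence. }
    split.
    - intros (u & v & Hu1 & Hv & Hg). exists u. split; [apply in_seq; lia|].
      apply Hu; eauto.
    - intros (u & Hs & H). apply in_seq in Hs. apply Hu in H as (v & Hv & Hg); [|lia].
      exists u, v. split; [lia|auto]. }
  destruct (existsb (fun u => mem s2' 3 u =? 4) (seq 0 N)); [left|right];
    (split; [|reflexivity]); rewrite Hiff; auto.
Qed.

End Reduction.

(** * Asymptotics *)

Local Open Scope R_scope.

(** This is [1 + y <= exp y] at [y = ln (eta * x)]. *)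
Lemma ln_le_scaled (eta x : R) : 0 < eta -> 0 < x -> ln x <= eta * x - ln eta.
Proof.
  intros He Hx. assert (Hp : 0 < eta * x) by now apply Rmult_lt_0_compat.
  pose proof (exp_ineq1_le (ln (eta * x))) as H.
  rewrite exp_ln, ln_mult in H by assumption. lra.
Qed.

Lemma ln_blowup_le (k : nat) (q eps : R) :
  0 <= q -> 0 < eps ->
  exists c, forall n, q * ln (INR (blowup k n)) <= c + eps * INR n.
Proof.
  intros Hq He. pose proof (pos_INR k) as Hk.
  assert (Hqk : 0 <= q * INR k) by now apply Rmult_le_pos.
  (* With this [eta] the slope [2 * (q * INR k) * eta] stays below [eps]; the added 1 avoids a zero
     denominator. *)
  set (eta := eps / (2 * (q * INR k + 1))).
  assert (Heta : 0 < eta) by (apply Rdiv_lt_0_compat; lra).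
  assert (Hmul : 2 * (q * INR k) * eta <= eps).
  { replace eps with (2 * (q * INR k + 1) * eta) at 1 by (unfold eta; field; lra).
    apply Rmult_le_compat_r; lra. }
  exists (q * ln 16 + q * INR k * (eta - ln eta)). intros n. pose proof (pos_INR n) as Hn.
  assert (H1 : 0 < 2 * INR n + 1) by lra.
  assert (E : ln (INR (blowup k n)) = ln 16 + INR k * ln (2 * INR n + 1)).
  { unfold blowup. rewrite mult_INR, pow_INR, plus_INR, mult_INR.
    replace (INR 16) with 16 by (cbn; lra). replace (INR 2) with 2 by reflexivity.
    replace (INR 1) with 1 by reflexivity.
    rewrite ln_mult, ln_pow; [reflexivity|exact H1|lra|now apply pow_lt]. }
  rewrite E. pose proof (ln_le_scaled eta _ Heta H1) as Hl.
  apply (Rmult_le_compat_l (q * INR k) _ _ Hqk) in Hl.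
  apply (Rmult_le_compat_r (INR n) _ _ Hn) in Hmul. lra.
Qed.

Lemma exp_le (x y : R) : x <= y -> exp x <= exp y.
Proof. intros [H| ->]; [apply Rlt_le, exp_increasing, H|apply Rle_refl]. Qed.

Lemma ln_le (x y : R) : 0 < x -> x <= y -> ln x <= ln y.
Proof. intros Hx [H| ->]; [apply Rlt_le, ln_increasing; assumption|apply Rle_refl]. Qed.

(** For a negative [a] the largest value is at the lower end [N]; the absolute value covers both
    signs. *)
Lemma Rpower_le_range (a N P x : R) :
  0 < N -> 1 <= P -> N <= x <= N * P -> Rpower x a <= exp (a * ln N + Rabs a * ln P).
Proof.
  intros HN HP [Hx1 Hx2]. unfold Rpower.
  assert (H1 : ln N <= ln x) by (apply ln_le; lra).
  assert (H2 : ln x <= ln N + ln P) by (rewrite <- ln_mult by lra; apply ln_le; lra).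
  apply exp_le.
  pose proof (Rle_abs a) as Ha. pose proof (Rabs_pos a) as Ha'.
  assert (a * (ln x - ln N) <= Rabs a * (ln x - ln N)) by (apply Rmult_le_compat_r; lra).
  assert (Rabs a * (ln x - ln N) <= Rabs a * ln P) by (apply Rmult_le_compat_l; lra).
  lra.
Qed.

(** * A time bound for k-SAT in terms of [n] alone *)

Definition list_Rmax (l : list R) : R := fold_right Rmax 0 l.

Lemma list_Rmax_ge l x : In x l -> x <= list_Rmax l.
Proof.
  induction l as [|y l IH]; intros []; cbn.
  - subst. apply Rmax_l.
  - eapply Rle_trans; [now apply IH|apply Rmax_r].
Qed.

Lemma list_Rmax_le l b : 0 <= b -> (forall x, In x l -> x <= b) -> list_Rmax l <= b.
Proof.
  intros Hb. induction l as [|y l IH]; intros H; cbn; [exact Hb|].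
  apply Rmax_lub; [apply H; now left|apply IH; intros; apply H; now right].
Qed.

Definition box (k n : nat) : list nat :=
  let N := (2 ^ half n)%nat in seq N (N * blowup k n + 1 - N).

Lemma in_box k n x :
  In x (box k n) <-> (2 ^ half n <= x <= 2 ^ half n * blowup k n)%nat.
Proof.
  unfold box. rewrite in_seq.
  assert (1 <= blowup k n)%nat
    by (unfold blowup; pose proof (Nat.pow_nonzero (2 * n + 1) k); lia).
  assert (2 ^ half n <= 2 ^ half n * blowup k n)%nat by nia. lia.
Qed.

(** The maximum over the box dominates [g] at the unknown numbers of edges and vertices, without any
    monotonicity of [g]. *)
Definition sat_time (g : nat -> nat -> R) (k n : nat) : R :=
  INR (200 * (k + 1) * (2 ^ half n * blowup k n)) +
  list_Rmax (map (fun '(m, v) => g m v) (list_prod (box k n) (box k n))).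

Lemma kSAT_of_eccentricities directed weighted g k :
  Eccentricities_in_time directed weighted g -> kSAT_in_time k (sat_time g k).
Proof.
  intros (p & c & Hp).
  exists (reduction directed weighted p), ((c + 1) * (2 * k + 110))%nat.
  intros F HF w Hw.
  destruct (reduction_correct directed weighted p c g Hp k F w HF Hw)
    as (m & v & Hm & Hv & t & s & He & Ht & Hpost).
  exists t, s. split; [exact He|]. split; [|exact Hpost].
  eapply Rle_trans; [exact Ht|]. unfold sat_time. apply Rplus_le_compat_l, list_Rmax_ge.
  apply in_map_iff. exists (m, v). split; [reflexivity|].
  apply in_prod; now apply in_box.
Qed.

(** With [gamma = Rmax (alpha + beta) 1], the exponent is the midpoint of [gamma / 2] and 1. The
    power [gamma] of [2 ^ half n] is about [2 ^ (gamma * n / 2)], and the gap up to the midpoint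
    absorbs the polynomial factors. *)
Lemma sat_time_big_O g alpha beta C n0 k :
  alpha + beta < 2 ->
  (forall m n, (n0 <= m)%nat -> (n0 <= n)%nat ->
     g m n <= C * (Rpower (INR m) alpha * Rpower (INR n) beta)) ->
  big_O (sat_time g k)
    (fun n => Rpower 2 ((1 / 2 + Rmax (alpha + beta) 1 / 4) * INR n)).
Proof.
  (* The maximum with 1 accounts for the construction, whose time is linear in [2 ^ half n]. *)
  intros Hab Hg. set (gamma := Rmax (alpha + beta) 1).
  assert (Hgamma : alpha + beta <= gamma /\ 1 <= gamma < 2).
  { unfold gamma. split; [apply Rmax_l|]. split; [apply Rmax_r|]. now apply Rmax_lub_lt; lra. }
  assert (Hln2 : 0 < ln 2) by (rewrite <- ln_1; apply ln_increasing; lra).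
  (* [q] bounds the power of [blowup] both in the bound on [g], where it is the sum of the absolute
     values, and in the construction, where it is 1. *)
  set (q := Rabs alpha + Rabs beta + 1).
  assert (Hq : 1 <= q) by (unfold q; pose proof (Rabs_pos alpha); pose proof (Rabs_pos beta); lra).
  destruct (ln_blowup_le k q ((1 / 2 - gamma / 4) * ln 2)) as [c Hc];
    [lra|apply Rmult_lt_0_compat; lra|].
  (* [c] comes from the polynomial factor, [gamma / 2 * ln 2] from rounding [n / 2] up. *)
  set (K := exp (c + gamma / 2 * ln 2)).
  assert (HK : 0 < K) by apply exp_pos.
  (* From [2 * n0] on, [half n] is at least [n0], hence so are all numbers in the box. The absolute
     value allows for a negative [C]. *)
  exists (200 * (INR k + 1) * K + Rabs C * K), (2 * n0)%nat. intros n Hn.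
  set (D := Rpower 2 ((1 / 2 + gamma / 4) * INR n)).
  assert (HD : 0 < D) by apply exp_pos.
  set (N := INR (2 ^ half n)). set (P := INR (blowup k n)).
  pose proof (half_spec n) as Hh.
  assert (HN : 0 < N) by (apply lt_0_INR, pow2_pos).
  assert (HP : 1 <= P).
  { apply (le_INR 1). unfold blowup. pose proof (Nat.pow_nonzero (2 * n + 1) k). lia. }
  assert (HlnP : 0 <= ln P) by (rewrite <- ln_1; apply ln_le; lra).
  assert (Hkey : forall a r, a <= gamma -> r <= q -> exp (a * ln N + r * ln P) <= K * D).
  { intros a r Ha Hr. unfold K, D, Rpower. rewrite <- exp_plus. apply exp_le.
    assert (r * ln P <= q * ln P) by now apply Rmult_le_compat_r.
    specialize (Hc n). fold P in Hc.
    assert (EN : ln N = INR (half n) * ln 2).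
    { unfold N. rewrite pow_INR, ln_pow; [reflexivity|cbn; lra]. }
    assert (Hhalf : 2 * INR (half n) <= INR n + 1).
    { pose proof (le_INR _ _ (proj2 Hh)) as H1. rewrite mult_INR, plus_INR in H1.
      change (INR 2) with 2 in H1. change (INR 1) with 1 in H1. lra. }
    pose proof (pos_INR (half n)) as Hh0.
    assert (a * INR (half n) <= gamma * INR (half n)) by now apply Rmult_le_compat_r.
    assert (gamma * (2 * INR (half n)) <= gamma * (INR n + 1))
      by (apply Rmult_le_compat_l; lra).
    assert (a * INR (half n) * ln 2 <= gamma * (INR n + 1) / 2 * ln 2)
      by (apply Rmult_le_compat_r; lra).
    rewrite EN. lra. }
  unfold sat_time. rewrite Rmult_plus_distr_r. apply Rplus_le_compat.
  - rewrite !mult_INR, plus_INR. fold N P.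
    replace (INR 200) with 200 by (rewrite INR_IZR_INZ; reflexivity).
    replace (INR 1) with 1 by reflexivity.
    rewrite (Rmult_assoc _ K D). apply Rmult_le_compat_l; [pose proof (pos_INR k); lra|].
    replace (N * P) with (exp (1 * ln N + 1 * ln P)).
    + apply Hkey; lra.
    + rewrite exp_plus, !Rmult_1_l, !exp_ln; lra.
  - apply list_Rmax_le; [apply Rmult_le_pos; [apply Rmult_le_pos; [apply Rabs_pos|lra]|lra]|].
    intros x Hx. apply in_map_iff in Hx as ([m v] & <- & Hx).
    apply in_prod_iff in Hx as [Hm Hv]. apply in_box in Hm, Hv.
    assert (Hbig : (n0 <= 2 ^ half n)%nat)
      by (pose proof (Nat.pow_gt_lin_r 2 (half n)); lia).
    assert (Hrange : forall y, (2 ^ half n <= y <= 2 ^ half n * blowup k n)%nat ->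
              N <= INR y <= N * P).
    { intros y [H1 H2]. unfold N, P. rewrite <- mult_INR. split; now apply le_INR. }
    eapply Rle_trans; [apply Hg; lia|].
    pose proof (Rpower_le_range alpha N P _ HN HP (Hrange m Hm)) as Ha.
    pose proof (Rpower_le_range beta N P _ HN HP (Hrange v Hv)) as Hb.
    assert (Hpos : forall x y, 0 < Rpower x y) by (intros; apply exp_pos).
    pose proof (Hpos (INR m) alpha) as Pa. pose proof (Hpos (INR v) beta) as Pb.
    assert (Hprod : Rpower (INR m) alpha * Rpower (INR v) beta <= K * D).
    { eapply Rle_trans; [apply Rmult_le_compat; [lra|lra|exact Ha|exact Hb]|].
      rewrite <- exp_plus.
      replace (alpha * ln N + Rabs alpha * ln P + (beta * ln N + Rabs beta * ln P))
        with ((alpha + beta) * ln N + (Rabs alpha + Rabs beta) * ln P) by ring.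
      apply Hkey; [lra|unfold q; lra]. }
    rewrite (Rmult_assoc _ K D).
    apply Rle_trans with (Rabs C * (Rpower (INR m) alpha * Rpower (INR v) beta)).
    + apply Rmult_le_compat_r; [apply Rmult_le_pos; lra|apply Rle_abs].
    + apply Rmult_le_compat_l; [apply Rabs_pos|exact Hprod].
Qed.

Theorem theorem5 :
  SETH ->
  forall directed weighted : bool,
    ~ exists g : nat -> nat -> R,
        sub_mn g /\ Eccentricities_in_time directed weighted g.
Proof.
  intros Hseth directed weighted (g & (alpha & beta & Hab & C & n0 & Hg) & Hecc).
  assert (Hdelta : 1 / 2 + Rmax (alpha + beta) 1 / 4 < 1).
  { assert (Rmax (alpha + beta) 1 < 2) by (apply Rmax_lub_lt; lra). lra. }
  destruct (Hseth _ Hdelta) as [k Hk]. apply Hk.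
  exists (sat_time g k). split.
  - now apply sat_time_big_O with C n0.
  - now apply kSAT_of_eccentricities with directed weighted.
Qed.
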